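(* Let $k\ge 3$ and $D\ge1$ be integers. There is a constant $C=C(k,D)$ such that the following holds. Let $H$ be a $k$-partite $k$-graph with slicewise VC-dimension at most $D$, and let $\varepsilon>0$. Then $H$ has an $\varepsilon$-homogeneous equipartition in which each part of $H$ is partitioned into at most $2^{(1/\varepsilon)^{C}}$ parts.
   Context: A $k$-partite $k$-graph $H$ has vertex set partitioned into parts $A_1,\dots,A_k$ and every edge contains exactly one vertex of each part. For distinct vertices $v_1,\dots,v_{k-2}$, their link $L(v_1,\dots,v_{k-2})$ is the graph on $V(H)\setminus\{v_1,\dots,v_{k-2}\}$ with edge set $\{xy: \{x,y,v_1,\dots,v_{k-2}\}\in E(H)\}$. The VC-dimension of a graph $G$ is the largest $d$ such that there are distinct vertices $v_1,\dots,v_d$ with the property that for every $S\subseteq[d]$ there is a vertex adjacent to all $v_i$, $i\in S$, and non-adjacent to all $v_j$, $j\notin S$. The slicewise VC-dimension of $H$ is the maximum VC-dimension of $L(v_1,\dots,v_{k-2})$ over all choices of distinct $v_1,\dots,v_{k-2}\in V(H)$. For sets $X_i\subseteq A_i$, $d(X_1,\dots,X_k)=e(X_1,\dots,X_k)/(|X_1|\cdots|X_k|)$, and $(X_1,\dots,X_k)$ is $\varepsilon$-homogeneous if $d(X_1,\dots,X_k)\in[0,\varepsilon]\cup[1-\varepsilon,1]$. A partition of $H$ consists of a partition $\mathcal P_i$ of $A_i$ for each $i\in[k]$; it is $\varepsilon$-homogeneous if the sum of $|X_1|\cdots|X_k|$ over all $(X_1,\dots,X_k)\in\mathcal P_1\times\dots\times\mathcal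 P_k$ that are not $\varepsilon$-homogeneous is at most $\varepsilon|A_1|\cdots|A_k|$. It is an equipartition if all parts of each $\mathcal P_i$ have equal size.
   Formalization: In the equipartition, ''equal size'' is read up to rounding: any two parts of the same vertex class differ in size by at most one, since with exactly equal sizes the claim fails, for example when all classes have large prime size. *)

(* Defs.v *)
From mathcomp Require Import all_boot all_order all_algebra.
From mathcomp Require Import reals exp.

Set Implicit Arguments.
Unset Strict Implicit.
Unset Printing Implicit Defensive.

Import Order.TTheory GRing.Theory Num.Theory.
Local Open Scope ring_scope.

(* Hypergraphs on V are given by their set of edges E. The parts A i are
   allowed to be empty; since they partition V, every edge has k vertices. *)
Definition kpartite_kgraph (k : nat) (V : finType)
    (A : 'I_k -> {set V}) (E : {set {set V}}) : Prop :=
  [/\ forall i j, i != j -> [disjoint A i & A j],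
      \bigcup_i A i = [set: V]
    & forall e, e \in E -> forall i, #|e :&: A i| = 1%N].

(* A graph is given by its vertex set W and its adjacency relation. The
   witness w may be one of the entries of v. *)
Definition shattered (V : finType) (W : {set V}) (adj : rel V)
    (d : nat) (v : d.-tuple V) : bool :=
  [&& uniq v, all (fun x => x \in W) v &
    [forall S : {set 'I_d},
      [exists w in W, [forall i, adj w (tnth v i) == (i \in S)]]]].

(* The range of d loses nothing, as the entries of v are distinct. The graph
   without vertices shatters nothing, and gets VC-dimension 0. *)
Definition vc_dim (V : finType) (W : {set V}) (adj : rel V) : nat :=
  \max_(d < #|V|.+1 | [exists v : d.-tuple V, shattered W adj v]) d.

Definition link_vertices (V : finType) (m : nat) (v : m.-tuple V) : {set V} :=
  [set x | x \notin v].

Definition link (V : finType) (E : {set {set V}}) (m : nat) (v : m.-tuple V) :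
    rel V :=
  fun x y => [&& x \in link_vertices v, y \in link_vertices v, x != y &
                 [set x; y] :|: [set z in v] \in E].

Definition slicewise_vc_dim (k : nat) (V : finType) (E : {set {set V}}) : nat :=
  \max_(v : (k - 2).-tuple V | uniq v) vc_dim (link_vertices v) (link E v).

Definition edges_between (k : nat) (V : finType) (E : {set {set V}})
    (X : 'I_k -> {set V}) : {set {set V}} :=
  [set e in E | [forall i, #|e :&: X i| == 1%N]].

Definition density (R : realType) (k : nat) (V : finType) (E : {set {set V}})
    (X : 'I_k -> {set V}) : R :=
  #|edges_between E X|%:R / \prod_i #|X i|%:R.

Definition homogeneous (R : realType) (eps : R) (k : nat) (V : finType)
    (E : {set {set V}}) (X : 'I_k -> {set V}) : bool :=
  (0 <= density R E X <= eps) || (1 - eps <= density R E X <= 1).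

Definition homogeneous_partition (R : realType) (eps : R) (k : nat)
    (V : finType) (A : 'I_k -> {set V}) (E : {set {set V}})
    (P : 'I_k -> {set {set V}}) : Prop :=
  \sum_(X : {ffun 'I_k -> {set V}} |
        [forall i, X i \in P i] && ~~ homogeneous eps E X)
     \prod_i #|X i|%:R
  <= eps * \prod_i #|A i|%:R.

(* "Equal size" is meant up to rounding: the number of parts need not divide
   #|A i|, so the sizes of the parts of A i may differ by one. *)
Definition equipartition (k : nat) (V : finType)
    (P : 'I_k -> {set {set V}}) : Prop :=
  forall i X Y, X \in P i -> Y \in P i -> (#|X| <= #|Y| + 1)%N.

(* Main.v *)
Require Import Defs.
From mathcomp Require Import all_boot all_order all_algebra.
From mathcomp Require Import reals exp.
From mathcomp Require Import zify ring lra.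

Import Order.TTheory GRing.Theory Num.Theory.
Local Open Scope ring_scope.
Set Implicit Arguments.
Unset Strict Implicit.
Unset Printing Implicit Defensive.

(* Let f be the indicator function of the edges on A_1 x ... x A_k. It suffices
   to find, for every i, an encoding of A_i by poly(1/eps) bits such that f is
   recovered up to a small error probability from the code of the i-th
   coordinate and the other coordinates: an equipartition of A_i that almost
   refines the classes of this code is then almost invariant, for f, under
   resampling each coordinate within its part, and this bounds the average of
   d(1 - d) over the cells, where d is the density.

   The code of a is built by induction on the number of coordinates. Let b and d
   be two further coordinates, sample r values d_i of d and q values b_j of b,
   and store the codes of a for the functions f(.., d = d_i) and
   f(.., b = b_j). For given values of a and the remaining coordinates, f is a
   bipartite graph of bounded VC-dimension between the values of b and those of
   d. By Sauer-Shelah its vertices b have at most (r + 1)^D traces on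
   d_1, ..., d_r, so most b share their trace with some b_j, and two vertices
   with equal traces have almost the same neighbours. Thus f at b is, up to a
   small error, f at the first b_j with the same trace, and both the traces and
   this value are known from the code. As r and q are poly(1/eps), so is the
   length of the code. *)

(** * The Sauer-Shelah lemma *)

Definition shatters (T : finType) (F : {set {set T}}) (S : {set T}) : bool :=
  [forall B : {set T}, (B \subset S) ==> [exists X in F, X :&: S == B]].

Lemma shattersP (T : finType) (F : {set {set T}}) (S : {set T}) :
  reflect (forall B : {set T}, B \subset S -> exists2 X, X \in F & X :&: S = B)
          (shatters F S).
Proof.
apply: (iffP forallP) => sh B.
  move=> sBS; have /implyP/(_ sBS)/existsP[X /andP[XF /eqP XB]] := sh B.
  by exists X.
apply/implyP => sBS; have [X XF XB] := sh B sBS.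
by apply/existsP; exists X; rewrite XF XB eqxx.
Qed.

Lemma sub_shatters (T : finType) (F G : {set {set T}}) (S : {set T}) :
  F \subset G -> shatters F S -> shatters G S.
Proof.
move=> /subsetP sFG /shattersP sh; apply/shattersP => B /sh[X XF XB].
by exists X => //; apply: sFG.
Qed.

(* Pajor's inequality: if x separates two members of F, the sets shattered by
   both {X in F | x \in X} and {X in F | x \notin X} remain shattered by F when
   x is added to them. *)
Lemma leq_card_shattered (T : finType) (F : {set {set T}}) :
  (#|F| <= #|[set S | shatters F S]|)%N.
Proof.
have [n] := ubnP #|F|; elim: n F => // n IHn F; rewrite ltnS => Fn.
case: (leqP #|F| 1) => [F1|].
  have [->|[X XF]] := set_0Vmem F; first by rewrite cards0.
  apply: (leq_trans F1); rewrite card_gt0; apply/set0Pn; exists set0.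
  rewrite inE; apply/shattersP => B; rewrite subset0 => /eqP->.
  by exists X => //; rewrite setI0.
case/card_gt1P => X [Y [XF YF neqXY]].
have [x xXY] : exists x, (x \in X) != (x \in Y).
  apply/existsP; apply: contraNT neqXY; rewrite negb_exists => /forallP eqXY.
  by apply/eqP/setP => x; have := eqXY x; rewrite negbK => /eqP.
pose G (b : bool) := [set Z in F | (x \in Z) == b].
have cardG : #|F| = (#|G true| + #|G false|)%N.
  rewrite -cardsUI -[LHS]addn0; congr (_ + _)%N.
    by apply: eq_card => Z; rewrite !inE; case: (x \in Z); case: (Z \in F).
  apply/esym/eqP; rewrite cards_eq0 -subset0; apply/subsetP => Z.
  by rewrite !inE; case: (x \in Z); rewrite ?andbF.
have G_gt0 b : (0 < #|G b|)%N.
  rewrite card_gt0; apply/set0Pn.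
  have := xXY; case: b; case xX: (x \in X); case xY: (x \in Y) => // _;
    first [by exists X; rewrite inE XF xX | by exists Y; rewrite inE YF xY].
have IHG b : (#|G b| <= #|[set S | shatters (G b) S]|)%N.
  apply: IHn; have := G_gt0 (~~ b); move: Fn; rewrite cardG; case: b => /=; lia.
have xG b S : shatters (G b) S -> x \notin S.
  move=> /shattersP sh; apply/negP => xS.
  (* All members of [G b] agree at [x], so a trace on [S] with the opposite value at [x] cannot be
     realised. *)
  have sBS : (if b then set0 else [set x]) \subset S.
    by case: (b); rewrite ?sub0set ?sub1set.
  have [Z] := sh _ sBS.
  rewrite inE => /andP[_ /eqP xZ] /setP/(_ x); rewrite inE xS xZ andbT.
  by case: (b); rewrite !inE ?eqxx.
rewrite cardG; apply: leq_trans (leq_add (IHG true) (IHG false)) _.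
rewrite -cardsUI; set U := _ :|: _; set N := _ :&: _.
have inj : {in N &, injective (fun S => x |: S)}.
  move=> S S'; rewrite !inE => /andP[/xG xS _] /andP[/xG xS' _] eqS.
  by rewrite -(setU1K xS) -(setU1K xS') eqS.
rewrite -(card_in_imset inj) -cardsUI.
suff -> : #|U :&: [set x |: S | S in N]| = 0%N.
  rewrite addn0; apply/subset_leq_card/subsetP => S; rewrite in_setU => /orP[|].
    by rewrite !inE => /orP[] /(sub_shatters _) -> //;
      apply/subsetP => Z; rewrite inE => /andP[].
  case/imsetP => S'; rewrite !inE => /andP[sh1 sh0] ->{S}.
  have xS := xG _ _ sh1.
  apply/shattersP => B sB.
  have [Z] : exists2 Z, Z \in G (x \in B) & Z :&: S' = B :\ x.
    have sBS : B :\ x \subset S' by rewrite subDset.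
    by case: (x \in B); [move/shattersP: sh1|move/shattersP: sh0]; apply.
  rewrite inE => /andP[ZF /eqP xZ] ZB; exists Z => //.
  apply/setP => y; move/setP/(_ y): ZB; rewrite !inE.
  have [->|/= _ ->] := eqVneq y x; first by rewrite /= andbT.
  by [].
apply/eqP; rewrite cards_eq0 -subset0; apply/subsetP => S; rewrite inE.
case/andP => SU /imsetP[S' _ ES]; move: SU; rewrite !inE ES.
by case/orP => /xG; rewrite !inE eqxx.
Qed.

Lemma card_small_sets (T : finType) (d : nat) :
  (#|[set S : {set T} | #|S| <= d]| <= #|T|.+1 ^ d)%N.
Proof.
pose h (u : {ffun 'I_d -> option T}) := [set x | [exists i, u i == Some x]].
rewrite -[X in (_ <= _ ^ X)%N]card_ord -card_option -card_ffun -cardsT.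
apply: leq_trans (leq_imset_card h setT); apply/subset_leq_card/subsetP => S.
rewrite inE => Sd; apply/imsetP.
exists [ffun i : 'I_d => onth (enum S) i]; rewrite ?inE //.
apply/setP => x; rewrite inE -mem_enum; apply/idP/existsP => [xS|[i]].
  have /onthP[n ny] := xS.
  have ltn : (n < d)%N by rewrite (leq_trans _ Sd) // cardE -onthTE ny.
  by exists (Ordinal ltn); rewrite ffunE /= ny.
by rewrite ffunE => /eqP ix; apply/onthP; exists i.
Qed.

Lemma sauer_shelah (T : finType) (F : {set {set T}}) (d : nat) :
  (forall S, shatters F S -> #|S| <= d)%N -> (#|F| <= #|T|.+1 ^ d)%N.
Proof.
move=> small; apply: leq_trans (leq_card_shattered F) _.
apply: leq_trans (card_small_sets T d); apply/subset_leq_card/subsetP => S.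
by rewrite !inE; apply: small.
Qed.

(** * Product expectations *)

Definition upd (I V : finType) (x : {ffun I -> V}) (i : I) (v : V) :
    {ffun I -> V} :=
  [ffun j => if j == i then v else x j].

Lemma upd_id (I V : finType) (x : {ffun I -> V}) (i : I) : upd x i (x i) = x.
Proof. by apply/ffunP => j; rewrite ffunE; case: eqP => [->|]. Qed.

Lemma upd_at (I V : finType) (x : {ffun I -> V}) (i : I) (v : V) :
  upd x i v i = v.
Proof. by rewrite ffunE eqxx. Qed.

Lemma upd_neq (I V : finType) (x : {ffun I -> V}) (i j : I) (v : V) :
  j != i -> upd x i v j = x j.
Proof. by rewrite ffunE => /negPf->. Qed.

Lemma upd_upd (I V : finType) (x : {ffun I -> V}) (i : I) (v w : V) :
  upd (upd x i v) i w = upd x i w.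
Proof. by apply/ffunP => j; rewrite !ffunE; case: eqP. Qed.

Lemma updC (I V : finType) (x : {ffun I -> V}) (i j : I) (v w : V) :
  i != j -> upd (upd x i v) j w = upd (upd x j w) i v.
Proof.
move=> neq; apply/ffunP => l; rewrite !ffunE.
by have [->|] := eqVneq l j; rewrite // eq_sym (negPf neq).
Qed.

Definition distr (R : realFieldType) (V : finType) (p : V -> R) : Prop :=
  (forall v, 0 <= p v) /\ \sum_v p v = 1.

(** The coordinates [x i] are independent with laws [p i]. For [I = 'I_q] and a constant family [p],
    this averages over [q] independent samples. *)
Definition Ex (R : realFieldType) (I V : finType) (p : I -> V -> R)
    (F : {ffun I -> V} -> R) : R :=
  \sum_(x : {ffun I -> V}) (\prod_i p i (x i)) * F x.

Section Expectation.
Variables (R : realFieldType) (I V : finType) (p : I -> V -> R).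
Implicit Types F G : {ffun I -> V} -> R.

Lemma eq_Ex F G : F =1 G -> Ex p F = Ex p G.
Proof. by move=> FG; apply: eq_bigr => x _; rewrite FG. Qed.

Lemma ExD F G : Ex p (fun x => F x + G x) = Ex p F + Ex p G.
Proof. by rewrite -big_split; apply: eq_bigr => x _; rewrite mulrDr. Qed.

Lemma Ex_sum (T : finType) (P : pred T) (F : T -> {ffun I -> V} -> R) :
  Ex p (fun x => \sum_(t | P t) F t x) = \sum_(t | P t) Ex p (F t).
Proof.
by rewrite [RHS]exchange_big; apply: eq_bigr => x _; rewrite mulr_sumr.
Qed.

Lemma ExZ (c : R) F : Ex p (fun x => c * F x) = c * Ex p F.
Proof. by rewrite mulr_sumr; apply: eq_bigr => x _; rewrite mulrCA. Qed.

Lemma Ex_prod (G : I -> V -> R) :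
  Ex p (fun x => \prod_i G i (x i)) = \prod_i \sum_v p i v * G i v.
Proof.
rewrite bigA_distr_bigA; apply: eq_bigr => x _.
by rewrite big_split.
Qed.

Lemma Ex_exchange (J W : finType) (q : J -> W -> R)
    (F : {ffun I -> V} -> {ffun J -> W} -> R) :
  Ex p (fun x => Ex q (F x)) = Ex q (fun y => Ex p (F^~ y)).
Proof.
transitivity (\sum_(x : {ffun I -> V}) \sum_(y : {ffun J -> W})
    (\prod_i p i (x i)) * (\prod_j q j (y j)) * F x y).
  apply: eq_bigr => x _; rewrite mulr_sumr.
  by apply: eq_bigr => y _; rewrite mulrA.
rewrite exchange_big; apply: eq_bigr => y _; rewrite mulr_sumr.
by apply: eq_bigr => x _; rewrite mulrA [_ * \prod_j _]mulrC.
Qed.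

(** Group the [y] by their coordinatewise image: the total weight of a fibre factors over the
    coordinates. *)
Lemma Ex_pushforward (W : finType) (q : I -> W -> R) (h : I -> W -> V) F :
  (forall i v, \sum_(w | h i w == v) q i w = p i v) ->
  Ex q (fun y => F [ffun i => h i (y i)]) = Ex p F.
Proof.
move=> hq; rewrite /Ex.
rewrite (partition_big
  (fun y : {ffun I -> W} => [ffun i => h i (y i)]) predT) //=.
apply: eq_bigr => x _.
have -> : \prod_i p i (x i) = \prod_i \sum_(w | h i w == x i) q i w.
  by apply: eq_bigr => i _; rewrite hq.
rewrite bigA_distr_big_dep mulr_suml.
apply: eq_big => [y|y /eqP->] //.
apply/eqP/familyP => [<- i|yx]; first by rewrite unfold_in /= ffunE.
by apply/ffunP => i; rewrite ffunE; apply/eqP/yx.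
Qed.

Hypothesis pP : forall i, distr (p i).

Lemma ler_Ex F G : (forall x, F x <= G x) -> Ex p F <= Ex p G.
Proof.
move=> FG; apply: ler_sum => x _; apply: ler_wpM2l => //.
by apply: prodr_ge0 => i _; case: (pP i).
Qed.

Lemma Ex_cst (c : R) : Ex p (fun=> c) = c.
Proof.
rewrite -[RHS]mulr1; transitivity (c * Ex p (fun=> 1)).
  by rewrite -ExZ; apply: eq_Ex => x; rewrite mulr1.
congr (_ * _); transitivity (Ex p (fun x => \prod_i (fun _ _ => 1) i (x i))).
  by apply: eq_Ex => x; rewrite big1.
rewrite (Ex_prod (fun _ _ => 1)) big1 // => i _.
by under eq_bigr do rewrite mulr1; case: (pP i).
Qed.

(** Otherwise [F - c] is positive everywhere with expectation zero, so all weights vanish, although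
    they sum to 1. *)
Lemma Ex_witness (c : R) F : Ex p F <= c -> exists x, F x <= c.
Proof.
move=> Fc; apply/existsP; apply: contraT; rewrite negb_exists => /forallP cF.
have cltF x : c < F x by rewrite ltNge cF.
suff : c < Ex p F by rewrite ltNge Fc.
rewrite -subr_gt0 lt_neqAle; apply/andP; split; last first.
  by rewrite subr_ge0 -[leLHS]Ex_cst; apply: ler_Ex => x; apply/ltW.
apply/negP => /eqP; rewrite -{1}[c]Ex_cst -mulN1r -ExZ -ExD => /esym/eqP.
have p0 (x : {ffun I -> V}) : 0 <= \prod_i p i (x i).
  by apply: prodr_ge0 => i _; case: (pP i).
rewrite psumr_eq0 => [/allP z|x _]; last first.
  by rewrite mulr_ge0 // mulN1r subr_ge0 ltW.
have /eqP := Ex_cst 1; rewrite /Ex big1 ?(eq_sym 0) ?oner_eq0 // => x _.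
have := z x (mem_index_enum x); rewrite mulf_eq0 mulr1 => /orP[/eqP//|].
by rewrite mulN1r subr_eq0 => /eqP E; have := cltF x; rewrite E ltxx.
Qed.

Lemma Ex_resample (i : I) F :
  Ex p (fun x => \sum_v p i v * F (upd x i v)) = Ex p F.
Proof.
transitivity (\sum_(x : {ffun I -> V}) \sum_v
    p i v * (\prod_j p j (x j)) * F (upd x i v)).
  by apply: eq_bigr => x _; rewrite mulr_sumr; apply: eq_bigr => v _; ring.
transitivity (\sum_(x : {ffun I -> V}) \sum_v
    p i v * (\prod_j p j (x j)) * F x); last first.
  apply: eq_bigr => x _; rewrite -!mulr_suml.
  by case: (pP i) => _ ->; rewrite mul1r.
rewrite !pair_big /=.
(* Exchanging [x i] with the fresh value is an involution that preserves the joint weight. *)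
pose s (z : {ffun I -> V} * V) := (upd z.1 i z.2, z.1 i).
have sK : involutive s.
  by case=> x v; rewrite /s /= upd_upd upd_id upd_at.
rewrite [RHS](reindex_inj (inv_inj sK)) /=; apply: eq_bigr => -[x v] _ /=.
congr (_ * _); rewrite (bigD1 i) // [in RHS](bigD1 i) //= upd_at mulrCA.
congr (_ * (_ * _)).
by apply: eq_bigr => j /(upd_neq x v) ->.
Qed.

Lemma Ex_coord (i : I) (G : V -> R) :
  Ex p (fun x => G (x i)) = \sum_v p i v * G v.
Proof.
rewrite -(Ex_resample i) /= -[RHS]Ex_cst; apply: eq_Ex => x.
by apply: eq_bigr => v _; rewrite upd_at.
Qed.

End Expectation.

Lemma ler_indicator (R : realFieldType) (a b : bool) :
  (a -> b) -> a%:R <= b%:R :> R.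
Proof. by case: a; case: b => // /(_ isT). Qed.

Lemma ler_indicatorU (R : realFieldType) (a b : bool) :
  (a || b)%:R <= a%:R + b%:R :> R.
Proof. by case: a; case: b; rewrite ?lerDl ?addr0 ?add0r. Qed.

Lemma ler_indicator_exists (R : realFieldType) (T : finType) (P : pred T) :
  [exists t, P t]%:R <= \sum_t (P t)%:R :> R.
Proof.
have [/existsP[t Pt]|_] := boolP [exists t, P t].
  by rewrite (bigD1 t) //= Pt lerDl sumr_ge0.
exact: sumr_ge0.
Qed.

(** * Sampled representatives *)

(** With the other coordinates fixed, [f] is a bipartite graph between the values of a coordinate
    [b] and those of [d]; this is the neighbourhood of [x b] among the samples [ds]. *)
Definition trace (I V : finType) (f : {ffun I -> V} -> bool) (d : I) (r : nat)
    (ds : {ffun 'I_r -> V}) (x : {ffun I -> V}) : {set 'I_r} :=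
  [set i | f (upd x d (ds i))].

(** Every bipartite graph obtained by fixing all but two coordinates has VC-dimension at most [D].
    Shattering forces [u] to be injective: take [B] to be a singleton. *)
Definition pair_vc_le (I V : finType) (D : nat) (f : {ffun I -> V} -> bool) :=
  forall (x : {ffun I -> V}) (i j : I) (u : 'I_D.+1 -> V), i != j ->
  ~ forall B : {set 'I_D.+1},
      exists v, forall t, f (upd (upd x i (u t)) j v) = (t \in B).

Lemma card_traces (I V : finType) (D : nat) (f : {ffun I -> V} -> bool)
    (b d : I) (r : nat) (ds : {ffun 'I_r -> V}) (x : {ffun I -> V}) :
  pair_vc_le D f -> b != d ->
  (#|[set trace f d ds (upd x b v) | v : V]| <= r.+1 ^ D)%N.
Proof.
move=> fD neq; rewrite -[r in r.+1]card_ord; apply: sauer_shelah => S sh.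
rewrite leqNgt; apply/negP => DS.
(* These are [D + 1] indices of [S]; the samples of [d] at them would be shattered by the values of
   [b]. *)
pose s t := enum_val (widen_ord DS t).
have s_inj : injective s.
  by move=> t t' /enum_val_inj/(congr1 val) /= tt'; apply: val_inj.
apply: (fD x d b (fun t => ds (s t))); first by rewrite eq_sym.
move=> B; have sBS : s @: B \subset S.
  by apply/subsetP => _ /imsetP[t _ ->]; apply: enum_valP.
have [_ /imsetP[v _ ->] /setP E] := shattersP _ _ sh _ sBS.
exists v => t; have := E (s t).
rewrite mem_imset // !inE enum_valP andbT => <-.
by rewrite updC // eq_sym.
Qed.

(** The sum of [y * (1 - y) ^+ i] over [i <= n] telescopes to at most 1, and each of its [n + 1]
    terms is at least the last one. *)
Lemma ler_geometric (R : realFieldType) (y : R) (n : nat) :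
  0 <= y <= 1 -> y * (1 - y) ^+ n <= n.+1%:R^-1.
Proof.
move=> /andP[y0 y1]; set z := 1 - y.
have z01 : 0 <= z <= 1 by rewrite /z; lra.
have [z0 z1] := andP z01.
rewrite -[X in _ <= X]mul1r ler_pdivlMr ?ltr0n //.
apply: (@le_trans _ _ (\sum_(i < n.+1) y * z ^+ i)).
  rewrite -[n.+1 in leLHS]card_ord -sumr_const mulr_sumr.
  by apply: ler_sum => i _; rewrite mulr1 ler_wpM2l // ler_wiXn2l // -ltnS.
have -> : y = - (z - 1) by rewrite /z; lra.
rewrite -mulr_sumr mulNr -subrX1 opprB gerBl; exact: exprn_ge0.
Qed.

Section Representatives.
Variables (R : realFieldType) (I V : finType) (p : I -> V -> R).
Hypothesis pP : forall i, distr (p i).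
Variables (D : nat) (f : {ffun I -> V} -> bool) (b d : I) (q r : nat).
Hypotheses (fD : pair_vc_le D f) (neq_bd : b != d).
Implicit Types (bs : {ffun 'I_q -> V}) (ds : {ffun 'I_r -> V}).
Implicit Types (x : {ffun I -> V}).

Definition rep bs ds x : option 'I_q :=
  [pick j | trace f d ds (upd x b (bs j)) == trace f d ds x].

Definition misrepresented bs ds x : bool :=
  if rep bs ds x is Some j then f (upd x b (bs j)) != f x else true.

Let neq_db : d != b. Proof. by rewrite eq_sym. Qed.

(** The measure of the symmetric difference of the neighbourhoods of [v] and [x b] among the values
    of [d]; it does not depend on [x d]. *)
Let distance x v :=
  \sum_w p d w * (f (upd (upd x b v) d w) != f (upd x d w))%:R.

Lemma trace_upd ds x v : trace f d ds (upd x d v) = trace f d ds x.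
Proof. by apply/setP => i; rewrite !inE upd_upd. Qed.

Lemma rep_upd bs ds x v : rep bs ds (upd x d v) = rep bs ds x.
Proof.
by apply: eq_pick => j /=; rewrite (updC _ _ _ neq_db) !trace_upd.
Qed.


Definition unmatched (W : finType) (h : V -> W) bs v : bool :=
  [forall j, h (bs j) != h v].

(** A class of [h] of mass [y] contains [v] but none of the [q] samples with probability
    [y * (1 - y) ^+ q], which is at most [1 / (q + 1)]; sum over the classes. *)
Lemma Ex_unmatched (W : finType) (h : V -> W) :
  \sum_v p b v * Ex (fun _ : 'I_q => p b) (fun bs => (unmatched h bs v)%:R)
    <= #|[set h v | v : V]|%:R / q.+1%:R.
Proof.
have [pb0 pb1] := pP b.
pose P w := \sum_(v | h v == w) p b v.
have P01 w : 0 <= P w <= 1.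
  rewrite sumr_ge0 //= -pb1 [leRHS](bigID (fun v => h v == w)) /= lerDl.
  exact: sumr_ge0.
have exE v :
    Ex (fun _ : 'I_q => p b) (fun bs => (unmatched h bs v)%:R)
    = (1 - P (h v)) ^+ q.
  transitivity (Ex (fun _ : 'I_q => p b)
    (fun bs => \prod_j (fun _ w => (h w != h v)%:R) j (bs j))).
    apply: eq_Ex => bs; rewrite /unmatched.
    have [/forallP nm|] := boolP [forall j, h (bs j) != h v].
      by rewrite big1 // => j _; rewrite nm.
    rewrite negb_forall => /existsP[j]; rewrite negbK => hj.
    by rewrite (bigD1 j) //= hj mul0r.
  rewrite (Ex_prod (fun _ : 'I_q => p b) (fun _ w => (h w != h v)%:R)).
  rewrite prodr_const card_ord; congr (_ ^+ _).
  apply/eqP; rewrite eq_sym subr_eq -[X in X == _]pb1 /P.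
  rewrite [X in _ == _ + X]big_mkcond -big_split.
  apply/eqP/eq_bigr => w _ /=.
  by case: eqP => _ /=; rewrite ?mulr0 ?mulr1 ?add0r ?addr0.
under eq_bigr do rewrite exE.
rewrite (partition_big h (fun w => w \in [set h v | v : V])) /=; last first.
  by move=> v _; apply: imset_f.
rewrite mulr_natl -sumr_const; apply: ler_sum => w _.
apply: le_trans (ler_geometric q (P01 w)); rewrite mulr_suml.
by apply/ler_sum => v /eqP->.
Qed.

(** Resampling [x b] makes it one more draw from [p b], independent of [bs]. The classes are those
    of equal trace, and [card_traces] bounds their number. *)
Lemma Ex_no_rep ds :
  Ex (fun _ : 'I_q => p b) (fun bs => Ex p (fun x =>
     [forall j, trace f d ds (upd x b (bs j)) != trace f d ds x]%:R))
    <= (r.+1 ^ D)%:R / q.+1%:R.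
Proof.
rewrite Ex_exchange -(Ex_resample pP b) -[leRHS](Ex_cst pP).
apply: ler_Ex => // x.
pose h v := trace f d ds (upd x b v).
apply: le_trans (_ : #|[set h v | v : V]|%:R / q.+1%:R <= _); last first.
  by rewrite ler_wpM2r ?invr_ge0 // ler_nat card_traces.
apply: le_trans (Ex_unmatched h); apply: ler_sum => v _.
rewrite ler_wpM2l; [by []|by case: (pP b)|].
apply: ler_Ex => // bs; apply: ler_indicator => /forallP nm.
by apply/forallP => j; have := nm j; rewrite upd_upd.
Qed.

Variable del : R.
Hypothesis del01 : 0 <= del <= 1.

(** At distance more than [del], each sample of [d] fails to separate the two neighbourhoods with
    probability at most [1 - del], independently; a union bound over the [q] samples of [b]
    follows. *)
Lemma Ex_far bs x :
  Ex (fun _ : 'I_r => p d) (fun ds =>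
     [exists j, (del < distance x (bs j)) &&
        (trace f d ds (upd x b (bs j)) == trace f d ds x)]%:R)
    <= q%:R * (1 - del) ^+ r.
Proof.
have [pd0 pd1] := pP d; have [del0 del1] := andP del01.
apply: le_trans (ler_Ex _ (fun ds => ler_indicator_exists _ _)) _ => //.
rewrite Ex_sum mulr_natl -[q in leRHS]card_ord -sumr_const.
apply: ler_sum => j _; have [far|_] := ltP del (distance x (bs j)); last first.
  by rewrite (Ex_cst (I := 'I_r) (p := fun=> p d)) // exprn_ge0 // subr_ge0.
pose agr w : R := (f (upd (upd x b (bs j)) d w) == f (upd x d w))%:R.
apply: le_trans (_ : Ex (fun _ : 'I_r => p d)
    (fun ds => \prod_i (fun _ => agr) i (ds i)) <= _).
  apply: ler_Ex => // ds; set t := trace _ _ _ _.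
  have [/setP eqT|_] := t =P trace f d ds x; last by apply: prodr_ge0.
  rewrite big1 //= => i _; have := eqT i.
  by rewrite /agr !inE => ->; rewrite eqxx.
rewrite (Ex_prod (fun _ : 'I_r => p d) (fun _ => agr)) prodr_const card_ord.
have sum0 : 0 <= \sum_w p d w * agr w.
  by apply: sumr_ge0 => w _; rewrite mulr_ge0.
apply: lerXn2r; rewrite ?nnegrE ?subr_ge0 //.
apply: le_trans (_ : 1 - distance x (bs j) <= _); last by rewrite lerB // ltW.
rewrite lerBrDr /distance -big_split /= -[leRHS]pd1; apply: ler_sum => w _.
by rewrite /agr; case: eqP => _ /=; rewrite ?mulr0 ?mulr1 ?add0r ?addr0.
Qed.

Let near bs ds x : bool := if rep bs ds x is Some j then
  (distance x (bs j) <= del) && (f (upd x b (bs j)) != f x) else false.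

(** Resampling [x d] changes neither the representative nor its distance, and that distance is the
    conditional probability of an error. *)
Lemma Ex_near bs ds : Ex p (fun x => (near bs ds x)%:R) <= del.
Proof.
rewrite /near.
have [pd0 pd1] := pP d; have [del0 del1] := andP del01.
rewrite -(Ex_resample pP d) -[leRHS](Ex_cst pP); apply: ler_Ex => // x.
under eq_bigr do rewrite rep_upd.
case: (rep bs ds x) => [j|]; last by rewrite big1 // => v _; rewrite mulr0.
have distU v : distance (upd x d v) (bs j) = distance x (bs j).
  apply: eq_bigr => w _.
  by rewrite (updC x _ _ neq_db) // !upd_upd.
under eq_bigr do rewrite distU.
have [le_del|_] := leP (distance x (bs j)) del; last first.
  by rewrite big1 // => v _; rewrite mulr0.
apply: le_trans le_del; apply: ler_sum => v _.
by rewrite (updC x _ _ neq_db).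
Qed.

(* A wrong representative is either at distance more than [del], and then it is
   unlikely to have the same trace, or it errs with probability at most [del],
   the choice of the representative being independent of [x d]. *)
Lemma Ex_misrepresented :
  Ex (fun _ : 'I_r => p d) (fun ds => Ex (fun _ : 'I_q => p b) (fun bs =>
    Ex p (fun x => (misrepresented bs ds x)%:R)))
  <= (r.+1 ^ D)%:R / q.+1%:R + q%:R * (1 - del) ^+ r + del.
Proof.
pose none bs ds x : bool :=
  [forall j, trace f d ds (upd x b (bs j)) != trace f d ds x].
pose far bs ds x : bool := [exists j, (del < distance x (bs j)) &&
  (trace f d ds (upd x b (bs j)) == trace f d ds x)].
pose pd := fun _ : 'I_r => p d; pose pb := fun _ : 'I_q => p b.
have pdP i : distr (pd i) by apply: pP.
have pbP i : distr (pb i) by apply: pP.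
apply: le_trans (_ : Ex pd (fun ds => Ex pb (fun bs => Ex p (fun x =>
    (none bs ds x)%:R + (far bs ds x)%:R + (near bs ds x)%:R))) <= _).
  apply: ler_Ex => // ds; apply: ler_Ex => // bs; apply: ler_Ex => // x.
  apply: le_trans (lerD (ler_indicatorU _ _ _) (lexx _)).
  apply: le_trans (ler_indicatorU _ _ _); apply: ler_indicator.
  rewrite /misrepresented /near /rep; case: pickP => [j /= tr mis|nm _].
    rewrite mis andbT; have [_|lt] := leP; first by rewrite orbT.
    by rewrite orbF; apply/orP; right; apply/existsP; exists j; rewrite lt.
  by apply/orP; left; apply/orP; left; apply/forallP => j; rewrite nm.
have split3 ds bs : Ex p (fun x =>
    (none bs ds x)%:R + (far bs ds x)%:R + (near bs ds x)%:R) =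
    Ex p (fun x => (none bs ds x)%:R) + Ex p (fun x => (far bs ds x)%:R)
    + Ex p (fun x => (near bs ds x)%:R) :> R by rewrite !ExD.
under eq_Ex => ds do under eq_Ex => bs do rewrite split3.
under eq_Ex => ds do rewrite !ExD.
rewrite !ExD; apply: lerD; first apply: lerD.
- rewrite -[leRHS](Ex_cst pdP); apply: ler_Ex => // ds; exact: Ex_no_rep.
- rewrite Ex_exchange -[leRHS](Ex_cst pbP); apply: ler_Ex => // bs.
  rewrite Ex_exchange -[leRHS](Ex_cst pP); apply: ler_Ex => // x.
  exact: Ex_far.
- rewrite -[leRHS](Ex_cst pdP); apply: ler_Ex => // ds.
  rewrite -[leRHS](Ex_cst pbP); apply: ler_Ex => // bs.
  exact: Ex_near.
Qed.

End Representatives.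

(** * Short codes *)

(** [phi] encodes the values of coordinate [a] and [g] decodes. Invariance under [upd x a v] says
    that the decoder learns about [x a] from the code alone. *)
Definition codable (R : realFieldType) (K I V : finType) (p : I -> V -> R)
    (f : {ffun I -> V} -> bool) (a : I) (err : R) : Prop :=
  exists (phi : V -> K) (g : K -> {ffun I -> V} -> bool),
    (forall c x v, g c (upd x a v) = g c x) /\
    Ex p (fun x => (f x != g (phi (x a)) x)%:R) <= err.

Lemma codable_le (R : realFieldType) (K I V : finType) (p : I -> V -> R)
    (f : {ffun I -> V} -> bool) (a : I) (err err' : R) :
  err <= err' -> codable K p f a err -> codable K p f a err'.
Proof.
by move=> le [phi [g [ga gerr]]]; exists phi, g; split=> //; apply: le_trans le.
Qed.

Definition depends_only_on (I V : finType) (S : {set I})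
    (f : {ffun I -> V} -> bool) : Prop :=
  forall x y : {ffun I -> V}, {in S, x =1 y} -> f x = f y.

Section Coding.
Variables (R : realFieldType) (I V : finType) (p : I -> V -> R).
Hypothesis pP : forall i, distr (p i).
Variables (D : nat) (f : {ffun I -> V} -> bool) (q r : nat) (del : R).
Hypotheses (fD : pair_vc_le D f) (del01 : 0 <= del <= 1).

Implicit Types (x y : {ffun I -> V}) (bs : {ffun 'I_q -> V}).
Implicit Types (ds : {ffun 'I_r -> V}).

Let sampling_error : R :=
  (r.+1 ^ D)%:R / q.+1%:R + q%:R * (1 - del) ^+ r + del.

(** Here [a] itself plays the role of [b]: the trace of [x] is determined by [x a] and is its code,
    and the decoder compares it with the traces of the fixed samples [bs]. *)
Lemma codable_pair (a d : I) :
  a != d -> depends_only_on [set a; d] f ->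
  codable {set 'I_r} p f a sampling_error.
Proof.
move=> neq fad; have := Ex_misrepresented pP q r fD neq del01.
case/Ex_witness => [i|ds]; first exact: pP.
case/Ex_witness => [i|bs err]; first exact: pP.
have traceE x y : x a = y a -> trace f d ds x = trace f d ds y.
  move=> xy; apply/setP => i; rewrite !inE; apply: fad => j.
  by rewrite !ffunE !inE => /orP[] /eqP->; rewrite ?eqxx // (negPf neq).
(* The constant point stands for any point with value [v] at [a], by [traceE]. *)
exists (fun v => trace f d ds [ffun=> v]), (fun c x =>
  if [pick j | trace f d ds (upd x a (bs j)) == c] is Some j
  then f (upd x a (bs j)) else false); split.
  move=> c x v; rewrite (@eq_pick _ _ (fun j =>
    trace f d ds (upd x a (bs j)) == c)) => [|j /=]; last by rewrite upd_upd.
  by case: pickP => // j _; rewrite upd_upd.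
apply: le_trans err; apply: ler_Ex => // x; apply: ler_indicator.
rewrite /misrepresented /rep (traceE [ffun=> x a] x) ?ffunE //.
by case: pickP => // j _; rewrite eq_sym.
Qed.

(** The decoder needs the trace of [x] ([r] values of [f]), the traces of the [q] points with a
    sample in place of [x b] ([r * q] values), and [f] at these points ([q] values). Each is decoded
    with error [err]; if all are correct, only misrepresentation can cause an error. *)
Lemma codable_step (K : finType) (a b d : I) (err : R) :
  a != b -> a != d -> b != d ->
  (forall v, codable K p (fun x => f (upd x d v)) a err) ->
  (forall v, codable K p (fun x => f (upd x b v)) a err) ->
  codable ({ffun 'I_r -> K} * {ffun 'I_q -> K})%type p f a
    (sampling_error + (r + r * q + q)%:R * err).
Proof.
move=> nab nad nbd /fin_all_exists[phid /fin_all_exists[gd Hd]].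
move=> /fin_all_exists[phib /fin_all_exists[gb Hb]].
pose wrongd v x := f (upd x d v) != gd v (phid v (x a)) x.
pose wrongb v x := f (upd x b v) != gb v (phib v (x a)) x.
pose pd := fun _ : 'I_r => p d; pose pb := fun _ : 'I_q => p b.
have pdP i : distr (pd i) by apply: pP.
have pbP i : distr (pb i) by apply: pP.
pose err1 ds x : R := \sum_(i : 'I_r) (wrongd (ds i) x)%:R.
pose err2 ds bs x : R :=
  \sum_(i : 'I_r) \sum_(j : 'I_q) (wrongd (ds i) (upd x b (bs j)))%:R.
pose err3 bs x : R := \sum_(j : 'I_q) (wrongb (bs j) x)%:R.
have E1 (ds : {ffun 'I_r -> V}) : Ex p (err1 ds) <= r%:R * err.
  rewrite Ex_sum mulr_natl -[r in leRHS]card_ord -sumr_const.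
  by apply: ler_sum => i _; have [_] := Hd (ds i).
have E3 (bs : {ffun 'I_q -> V}) : Ex p (err3 bs) <= q%:R * err.
  rewrite Ex_sum mulr_natl -[q in leRHS]card_ord -sumr_const.
  by apply: ler_sum => j _; have [_] := Hb (bs j).
(* For fixed [bs], the point [upd x b (bs j)] does not have law [p]. Averaged over [bs] it does, by
   resampling, so this error is bounded only on average. *)
have E2 (ds : {ffun 'I_r -> V}) :
    Ex pb (fun bs => Ex p (err2 ds bs)) <= (r * q)%:R * err.
  rewrite Ex_exchange natrM -mulrA mulr_natl -[r in leRHS]card_ord -sumr_const.
  under eq_Ex do rewrite Ex_sum.
  rewrite Ex_sum; apply: ler_sum => i _; under eq_Ex do rewrite Ex_sum.
  rewrite Ex_sum mulr_natl -[q in leRHS]card_ord -sumr_const.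
  apply: ler_sum => j _; have [_] := Hd (ds i); apply: le_trans.
  rewrite -[leRHS](Ex_resample pP b); apply: ler_Ex => // x.
  rewrite (Ex_coord pbP j (fun v => (wrongd (ds i) (upd x b v))%:R)).
  by apply: ler_sum => v _; rewrite /wrongd.
pose total ds bs x : R :=
  (misrepresented f b d bs ds x)%:R + err1 ds x + err2 ds bs x + err3 bs x.
have : Ex pd (fun ds => Ex pb (fun bs => Ex p (total ds bs)))
    <= sampling_error + (r + r * q + q)%:R * err.
  have -> : sampling_error + (r + r * q + q)%:R * err =
    sampling_error + r%:R * err + (r * q)%:R * err + q%:R * err.
    by rewrite !natrD !mulrDl !addrA.
  have split4 ds bs : Ex p (total ds bs) =
      Ex p (fun x => (misrepresented f b d bs ds x)%:R) + Ex p (err1 ds)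
      + Ex p (err2 ds bs) + Ex p (err3 bs) by rewrite !ExD.
  under eq_Ex => ds do under eq_Ex => bs do rewrite split4.
  under eq_Ex => ds do rewrite !ExD.
  rewrite !ExD; apply: lerD; first apply: lerD; first apply: lerD.
  - exact: Ex_misrepresented.
  - rewrite -[leRHS](Ex_cst pdP); apply: ler_Ex => // ds.
    by rewrite -[leRHS](Ex_cst pbP); apply: ler_Ex.
  - by rewrite -[leRHS](Ex_cst pdP); apply: ler_Ex.
  - rewrite -[leRHS](Ex_cst pdP); apply: ler_Ex => // ds.
    by rewrite -[leRHS](Ex_cst pbP); apply: ler_Ex.
case/Ex_witness => // ds; case/Ex_witness => // bs bound.
(* The trace as the decoder computes it from the first half of the code. *)
pose dtrace (c : {ffun 'I_r -> K} * {ffun 'I_q -> K}) x : {set 'I_r} :=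
  [set i | gd (ds i) (c.1 i) x].
have dtrace_a c x v : dtrace c (upd x a v) = dtrace c x.
  by apply/setP => i; rewrite !inE; have [-> _] := Hd (ds i).
exists (fun v => ([ffun i => phid (ds i) v], [ffun j => phib (bs j) v])).
exists (fun c x =>
  if [pick j | dtrace c (upd x b (bs j)) == dtrace c x] is Some j
  then gb (bs j) (c.2 j) x else false); split.
  move=> c x v; rewrite (@eq_pick _ _ (fun j =>
    dtrace c (upd x b (bs j)) == dtrace c x)) => [|j /=]; last first.
    by rewrite (updC _ _ _ nab) !dtrace_a.
  by case: pickP => // j _; have [-> _] := Hb (bs j).
apply: le_trans bound; apply: ler_Ex => // x; rewrite /total.
have nn1 : 0 <= err1 ds x by apply: sumr_ge0.
have nn2 : 0 <= err2 ds bs x by apply: sumr_ge0 => i _; apply: sumr_ge0.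
have nn3 : 0 <= err3 bs x by apply: sumr_ge0.
set code := (_, _); set lhs := leLHS; set mis := (X in X + _ + _ + _).
have lhs1 : lhs <= 1 by rewrite /lhs; case: (_ != _).
have mis0 : 0 <= mis by [].
(* One wrong decoding already makes the right-hand side at least 1. Otherwise the decoded traces are
   the true ones, and [pick] selects the same index as [rep]. *)
have [/existsP[i wi]|/existsPn ok1] := boolP [exists i, wrongd (ds i) x].
  have : 1 <= err1 ds x by rewrite /err1 (bigD1 i) //= wi lerDl sumr_ge0.
  by lra.
have [/existsP[i /existsP[j wij]]|/existsPn ok2] :=
    boolP [exists i, exists j, wrongd (ds i) (upd x b (bs j))].
  have : 1 <= err2 ds bs x.
    rewrite /err2 (bigD1 i) //= (bigD1 j) //= wij -addrA lerDl addr_ge0 //.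
      exact: sumr_ge0.
    by apply: sumr_ge0 => i' _; apply: sumr_ge0.
  by lra.
have [/existsP[j wj]|/existsPn ok3] := boolP [exists j, wrongb (bs j) x].
  have : 1 <= err3 bs x by rewrite /err3 (bigD1 j) //= wj lerDl sumr_ge0.
  by lra.
rewrite -!addrA [leRHS]addrC -[leLHS]add0r lerD ?addr_ge0 //.
rewrite {}/lhs {}/mis in lhs1 mis0 *.
apply: ler_indicator; rewrite /misrepresented /rep.
have dtraceE : dtrace code x = trace f d ds x.
  apply/setP => i; rewrite !inE ffunE.
  by have := ok1 i; rewrite negbK => /eqP.
have dtrace_bE j : dtrace code (upd x b (bs j)) = trace f d ds (upd x b (bs j)).
  apply/setP => i; rewrite !inE ffunE.
  have := ok2 i; rewrite negb_exists => /forallP/(_ j).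
  by rewrite negbK upd_neq // => /eqP.
rewrite dtraceE (@eq_pick _ _ (fun j =>
  trace f d ds (upd x b (bs j)) == trace f d ds x)); last first.
  by move=> j; rewrite /= dtrace_bE.
case: pickP => // j _; have := ok3 j; rewrite negbK ffunE => /eqP <-.
by rewrite eq_sym.
Qed.

End Coding.

(** * Polynomial bounds and the choice of the sample sizes *)

Definition poly_bounded (h : nat -> nat) : Prop :=
  exists e, forall m, (2 <= m)%N -> (h m <= m ^ e)%N.

Lemma poly_bounded_id : poly_bounded id.
Proof. by exists 1%N => m _; rewrite expn1. Qed.

(** As [m] is at least 2, constant factors are absorbed into a power of [m]. *)
Lemma poly_bounded_cst (c : nat) : poly_bounded (fun=> c).
Proof.
by exists c => m m2; rewrite (leq_trans (ltnW (ltn_expl c m2))).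
Qed.

Lemma poly_boundedM (g h : nat -> nat) :
  poly_bounded g -> poly_bounded h -> poly_bounded (fun m => g m * h m)%N.
Proof.
move=> [e ge] [e' he]; exists (e + e')%N => m m2.
by rewrite expnD leq_mul ?ge ?he.
Qed.

Lemma poly_boundedD (g h : nat -> nat) :
  poly_bounded g -> poly_bounded h -> poly_bounded (fun m => g m + h m)%N.
Proof.
move=> [e ge] [e' he]; exists (maxn e e').+1 => m m2.
rewrite expnS (leq_trans _ (leq_mul m2 (leqnn _))) // mul2n -addnn.
have m0 : (0 < m)%N by apply: ltnW.
apply: leq_add; [apply: leq_trans (ge m m2) _|apply: leq_trans (he m m2) _];
  by rewrite leq_pexp2l ?leq_maxl ?leq_maxr.
Qed.

Lemma poly_boundedX (h : nat -> nat) (d : nat) :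
  poly_bounded h -> poly_bounded (fun m => h m ^ d)%N.
Proof.
move=> hP; elim: d => [|d IHd]; first exact: poly_bounded_cst 1%N.
have [e he] := poly_boundedM hP IHd.
by exists e => m m2; rewrite expnS he.
Qed.

(** With [r = 4 * m * (c * m)] and [q = 4 * m * r.+1 ^ D], this reads [4 * m * q <= 2 ^ (c * m)]. *)
Lemma leq_expn_of_large (D : nat) :
  exists c, forall m, (2 <= m)%N ->
    (4 * m * (4 * m * (4 * m * (c * m)).+1 ^ D) <= 2 ^ (c * m))%N.
Proof.
(* The left side is at most [2 ^ (4 + (2 * D + 8) * D) * m ^ (2 * D + 2)], and [c'] exceeds both
   exponents. One half of [c' * 2] pays for the power of 2, the other for the power of [m], as
   [m < 2 ^ m]. *)
pose c' := (2 ^ (2 * D + 4))%N; exists (c' * 2)%N => m m2.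
have m0 : (0 < m)%N by apply: ltnW.
have c'_ge : (4 + (2 * D + 8) * D + (2 * D + 2) <= c')%N.
  rewrite /c' expnD mulnC expnM.
  have D4 : ((D + 1) ^ 2 <= 4 ^ D)%N.
    rewrite -[4%N]/(2 ^ 2)%N -expnM mulnC expnM leq_exp2r // addn1.
    exact: ltn_expl.
  rewrite -[(2 ^ 2)%N]/4%N -[(2 ^ 4)%N]/16%N; nia.
have c'0 : (0 < c')%N by rewrite expn_gt0.
apply: leq_trans (_ : 2 ^ c' * m ^ c' <= _)%N; last first.
  rewrite (_ : c' * 2 * m = c' * m + m * c')%N; last by ring.
  rewrite expnD leq_mul //; first by rewrite leq_exp2l // leq_pmulr.
  by rewrite expnM leq_exp2r // ltnW // ltn_expl.
apply: leq_trans (_ : 4 * m * (4 * m * (16 * c' * m ^ 2) ^ D) <= _)%N.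
  rewrite !leq_mul2l; apply/orP; right; apply/orP; right.
  case: (D) => // D'; rewrite leq_exp2r //; nia.
have -> : (4 * m * (4 * m * (16 * c' * m ^ 2) ^ D)
          = 2 ^ (4 + (2 * D + 8) * D) * m ^ (2 * D + 2))%N.
  rewrite (_ : 16 * c' = 2 ^ (2 * D + 8))%N; last first.
    by rewrite /c' !expnD; ring.
  rewrite expnMn -!expnM [(2 ^ (4 + _))%N]expnD [(m ^ (_ + 2))%N]expnD.
  by rewrite -[(2 ^ 4)%N]/16%N; ring.
by apply: leq_mul; rewrite ?leq_pexp2l //; apply: leq_trans c'_ge;
  rewrite ?leq_addr ?leq_addl.
Qed.

(** With [x = 1 / n], Bernoulli gives [(1 + x) ^+ n >= 2], while [(1 - x) * (1 + x) <= 1]. *)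
Lemma expr_1_sub_inv_le_half (R : realFieldType) (n : nat) :
  (0 < n)%N -> (1 - n%:R^-1) ^+ n <= 2^-1 :> R.
Proof.
move=> n0; set x : R := n%:R^-1.
have nR : 0 < n%:R :> R by rewrite ltr0n.
have x0 : 0 < x by rewrite invr_gt0.
have x1 : x <= 1 by rewrite invf_le1 // ler1n.
have two : 2 <= (1 + x) ^+ n.
  have bernoulli j : 1 + j%:R * x <= (1 + x) ^+ j.
    elim: j => [|j IHj]; first by rewrite mul0r addr0.
    rewrite exprS; apply: le_trans (ler_wpM2l _ IHj); last by lra.
    have : 0 <= j%:R * x * x by rewrite !mulr_ge0 // ltW.
    by rewrite -natr1; nra.
  apply: le_trans (bernoulli n); rewrite /x mulfV ?lt0r_neq0 //.
have : (1 - x) ^+ n * (1 + x) ^+ n <= 1.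
  rewrite -exprMn; apply: exprn_ile1; nra.
have : 0 <= (1 - x) ^+ n by apply: exprn_ge0; lra.
move: two; set u := (1 + x) ^+ n; set w := (1 - x) ^+ n; nra.
Qed.

(** The sampling error for [del = 1 / (4m)], each of its three terms being at most [1 / (4m)]: [q]
    is chosen for the first one, and [r] makes the power in the second at most [2 ^ - (c * m)]. The
    rest of the budget [1 / m] is left for the recursion. *)
Lemma sampling_parameters (R : realFieldType) (D : nat) :
  exists r q : nat -> nat,
    [/\ poly_bounded r, poly_bounded q, forall m, (2 <= m)%N -> (0 < q m)%N
      & forall m, (2 <= m)%N ->
        ((r m).+1 ^ D)%:R / (q m).+1%:R
          + (q m)%:R * (1 - (4 * m)%:R^-1) ^+ r m + (4 * m)%:R^-1
        <= 3 / (4 * m%:R) :> R].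
Proof.
have [c hc] := leq_expn_of_large D.
pose r m := (4 * m * (c * m))%N; pose q m := (4 * m * (r m).+1 ^ D)%N.
have pid := poly_bounded_id; have pcst := poly_bounded_cst.
have rP : poly_bounded r.
  exact: poly_boundedM (poly_boundedM (pcst 4%N) pid)
                       (poly_boundedM (pcst c) pid).
exists r, q; split=> //.
- apply: poly_boundedM; first exact: poly_boundedM (pcst 4%N) pid.
  have [e he] := poly_boundedX D (poly_boundedD rP (pcst 1%N)).
  by exists e => m m2; rewrite -addn1 he.
- by move=> m m2; rewrite !muln_gt0 expn_gt0 /= andbT ltnW.
move=> m m2; have m0 : (0 < m)%N by apply: ltnW.
have m4 : 0 < (4 * m)%:R :> R by rewrite ltr0n muln_gt0.
have -> : 3 / (4 * m%:R) = (4 * m)%:R^-1 + (4 * m)%:R^-1 + (4 * m)%:R^-1 :> R.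
  by rewrite natrM; field; rewrite pnatr_eq0 -lt0n.
apply: lerD => //; apply: lerD.
  rewrite ler_pdivrMr ?ltr0n // mulrC ler_pdivlMr // -natrM ler_nat /q.
  by rewrite mulnC ltnW.
rewrite -[leRHS]mul1r ler_pdivlMr // mulrAC -natrM.
rewrite /r exprM; apply: le_trans (_ : (2 ^ (c * m))%:R * 2^-1 ^+ (c * m) <= _).
  apply: ler_pM => //.
  - by apply/exprn_ge0/exprn_ge0; rewrite subr_ge0 invf_le1 // ler1n muln_gt0.
  - rewrite ler_nat mulnC /q -mulnA mulnA; apply: leq_trans (hc m m2).
    by rewrite -!mulnA.
  - apply: lerXn2r; rewrite ?nnegrE ?invr_ge0 //.
      by apply: exprn_ge0; rewrite subr_ge0 invf_le1 // ler1n muln_gt0.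
    by apply: expr_1_sub_inv_le_half; rewrite muln_gt0.
by rewrite natrX exprVn mulfV // expf_neq0 // pnatr_eq0.
Qed.

Lemma pair_vc_le_upd (I V : finType) (D : nat) (f : {ffun I -> V} -> bool)
    (d : I) (v : V) :
  (0 < D)%N -> pair_vc_le D f -> pair_vc_le D (fun x => f (upd x d v)).
Proof.
move=> D0 fD x i j u neq all.
(* If [d = i], the [D + 1 >= 2] points [u t] become indistinguishable and no singleton is a trace;
   if [d = j], all [v] give the same trace. *)
have [Ed|ndi] := eqVneq d i.
  have njd : j != d by rewrite Ed eq_sym.
  have [w wE] := all [set ord0]; have := wE ord0; have := wE ord_max.
  rewrite -!Ed !(updC _ _ _ njd) !upd_upd !inE eqxx => ->.
  by move/eqP/(congr1 val) => /= E; rewrite E in D0.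
have [Ed|ndj] := eqVneq d j.
  have [w wE] := all set0; have [w' wE'] := all setT.
  by have := wE ord0; have := wE' ord0; rewrite -!Ed !upd_upd !inE => ->.
apply: (fD (upd x d v) i j u neq) => B; have [w wE] := all B; exists w => t.
rewrite -wE; congr f; rewrite [in RHS]updC 1?eq_sym //.
by rewrite [in LHS](updC _ _ _ ndi).
Qed.

Lemma depends_only_on_upd (I V : finType) (S : {set I})
    (f : {ffun I -> V} -> bool) (d : I) (v : V) :
  depends_only_on S f -> depends_only_on (S :\ d) (fun x => f (upd x d v)).
Proof.
move=> fS x y xy; apply: fS => i iS; rewrite !ffunE.
by have [//|nid] := eqVneq i d; apply: xy; rewrite !inE nid iS.
Qed.

(** Induction on the number of coordinates besides [a]. A step fixes one of two of them by sampling
    and stores [r + q] codes of the previous level, so the number of bits stays polynomial in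
    [m]. *)
Lemma codable_poly (R : realFieldType) (D n : nat) :
  (0 < D)%N ->
  exists e, forall m, (2 <= m)%N ->
  exists2 K : finType, (#|K| <= 2 ^ (m ^ e))%N &
    forall (I V : finType) (p : I -> V -> R) (f : {ffun I -> V} -> bool)
        (a : I) (J : {set I}),
      (forall i, distr (p i)) -> pair_vc_le D f -> a \notin J ->
      depends_only_on (a |: J) f -> #|J| = n.+1 ->
    codable K p f a m%:R^-1.
Proof.
move=> D0; have [r [q [rP qP q_gt0 bound]]] := sampling_parameters R D.
have del01 m : (2 <= m)%N -> 0 <= ((4 * m)%:R^-1 : R) <= 1.
  move=> m2; have m0 : (0 < m)%N by apply: ltnW.
  by rewrite invr_ge0 ler0n invf_le1 ?ler1n ?ltr0n muln_gt0.
elim: n => [|n [e IHn]].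
  have [e re] := rP; exists e => m m2.
  exists {set 'I_(r m)} => [|I V p f a J pP fD aJ faJ cardJ].
    by rewrite -cardsT -powersetT card_powerset cardsT card_ord leq_pexp2l ?re.
  have /cards1P[d EJ] : #|J| == 1%N by rewrite cardJ.
  have nad : a != d by move: aJ; rewrite EJ inE.
  rewrite EJ in faJ.
  apply: codable_le (codable_pair pP (q m) (r m) fD (del01 m m2) nad faJ).
  apply: le_trans (bound m m2) _; rewrite invfM mulrA.
  by rewrite ler_piMl ?invr_ge0 //; lra.
have pid := poly_bounded_id; have pcst := poly_bounded_cst.
pose w m := (r m + r m * q m + q m)%N.
have wP : poly_bounded w.
  exact: poly_boundedD (poly_boundedD rP (poly_boundedM rP qP)) qP.
(* The step adds up [w m] errors of the previous level; at accuracy [1 / m'] they contribute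
   [1 / (4m)], completing the sampling error [3 / (4m)] to [1 / m]. *)
pose m' m := (4 * m * w m)%N.
have w_gt0 m : (2 <= m)%N -> (0 < w m)%N.
  by move=> m2; rewrite addn_gt0 q_gt0 // orbT.
have m'2 m : (2 <= m)%N -> (2 <= m' m)%N.
  by move=> m2; have := w_gt0 m m2; rewrite /m'; nia.
have m'P : poly_bounded m'.
  exact: poly_boundedM (poly_boundedM (pcst 4%N) pid) wP.
have [e' He'] := poly_boundedM (poly_boundedX e m'P) (poly_boundedD rP qP).
exists e' => m m2; have [K cardK codK] := IHn (m' m) (m'2 m m2).
exists ({ffun 'I_(r m) -> K} * {ffun 'I_(q m) -> K})%type.
  rewrite card_prod !card_ffun !card_ord -expnD.
  apply: leq_trans (_ : (2 ^ (m' m ^ e)) ^ (r m + q m) <= _)%N.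
    by case: (r m + q m)%N => // l; rewrite leq_exp2r.
  by rewrite -expnM leq_pexp2l ?He'.
move=> I V p f a J pP fD aJ faJ cardJ.
have [b bJ] : exists b, b \in J by apply/card_gt0P; rewrite cardJ.
have cardJb : #|J :\ b| = n.+1 by move: cardJ; rewrite (cardsD1 b) bJ => -[].
have [d dJb] : exists d, d \in J :\ b by apply/card_gt0P; rewrite cardJb.
have [ndb dJ] : d != b /\ d \in J by apply/andP; rewrite -in_setD1.
have nab : a != b by apply: contraNneq aJ => ->.
have nad : a != d by apply: contraNneq aJ => ->.
have nbd : b != d by rewrite eq_sym.
have restr i v : i \in J -> a != i ->
    codable K p (fun x => f (upd x i v)) a (m' m)%:R^-1.
  move=> iJ nai; apply: (codK _ _ _ _ _ (J :\ i)) => //.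
  - exact: pair_vc_le_upd.
  - by rewrite !inE (negPf aJ) andbF.
  - rewrite (_ : a |: J :\ i = (a |: J) :\ i); first exact: depends_only_on_upd.
    by apply/setP => j; rewrite !inE; have [->|] := eqVneq j a; rewrite ?nai.
  - by move: cardJ; rewrite (cardsD1 i) iJ => -[].
apply: codable_le (codable_step pP (q m) (r m) fD (del01 m m2) nab nad nbd
  (fun v => restr d v dJ nad) (fun v => restr b v bJ nab)).
have m0 : m%:R != 0 :> R by rewrite pnatr_eq0 -lt0n ltnW.
have w0 : (w m)%:R != 0 :> R by rewrite pnatr_eq0 -lt0n w_gt0.
have -> : m%:R^-1 = 3 / (4 * m%:R) + (w m)%:R / (m' m)%:R :> R.
  by rewrite /m' !natrM; field; rewrite m0 w0.
by rewrite lerD ?bound.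
Qed.

(** * Equipartitions almost refining a colouring *)

Definition monochromatic (V K : finType) (phi : V -> K) (X : {set V}) : bool :=
  [forall u in X, forall v in X, phi u == phi v].

Lemma monochromaticP (V K : finType) (phi : V -> K) (X : {set V}) :
  reflect {in X &, forall u v, phi u = phi v} (monochromatic phi X).
Proof.
apply: (iffP forall_inP) => [mX u v uX vX|mX u uX].
  by have /forall_inP/(_ v vX)/eqP := mX u uX.
by apply/forall_inP => v vX; apply/eqP/mX.
Qed.

Lemma count_iota (a b n : nat) :
  (a <= b)%N -> (b <= n)%N ->
  count (fun i => a <= i < b)%N (iota 0 n) = (b - a)%N.
Proof.
move=> ab bn; rewrite -[n](subnKC bn) -[in iota 0 _](subnKC ab).
rewrite !iotaD !count_cat.
rewrite !add0n subnKC //.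
rewrite (_ : count _ (iota 0 a) = 0%N) ?add0n; last first.
  by apply/eqP; rewrite -leqn0 leqNgt -has_count; apply/hasPn => i;
    rewrite mem_iota add0n => /andP[_ ia]; rewrite leqNgt ia.
rewrite (_ : count _ (iota b _) = 0%N) ?addn0; last first.
  by apply/eqP; rewrite -leqn0 leqNgt -has_count; apply/hasPn => i;
    rewrite mem_iota => /andP[bi _]; rewrite [(i < b)%N]ltnNge bi andbF.
rewrite -[RHS](size_iota a); apply/eqP; rewrite -all_count.
by apply/allP => i; rewrite mem_iota subnKC.
Qed.

(** Sort [A] by colour and cut it into consecutive blocks of almost equal size. At most [#|K|]
    blocks contain a change of colour, each of size at most [2 * #|A| / T]. *)
Lemma exists_equipartition (V K : finType) (A : {set V}) (phi : V -> K)
    (T : nat) :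
  (0 < T)%N ->
  exists P : {set {set V}},
    [/\ partition P A, {in P &, forall X Y : {set V}, (#|X| <= #|Y| + 1)%N},
        (#|P| <= T)%N
      & ((\sum_(X in P | ~~ monochromatic phi X) #|X|) * T
          <= 2 * #|K| * #|A|)%N].
Proof.
move=> T0; set n := #|A|.
have [n0|n_gt0] := posnP n.
  exists set0; split; first 1 last.
  - by move=> X Y; rewrite inE.
  - by rewrite cards0.
  - by rewrite big1 // => X; rewrite inE.
  rewrite (cards0_eq n0) /partition /cover big_set0 eqxx inE andbT.
  by apply/trivIsetP => X Y; rewrite inE.
have [x0 _] : exists x, x \in A by apply/card_gt0P.
pose key v := nat_of_ord (enum_rank (phi v)).
pose s := sort (relpre key leq) (enum A).
have us : uniq s by rewrite sort_uniq enum_uniq.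
have mems v : (v \in s) = (v \in A) by rewrite mem_sort mem_enum.
have size_s : size s = n by rewrite size_sort -cardE.
have keyS i j : (i <= j)%N -> (j < n)%N ->
    (key (nth x0 s i) <= key (nth x0 s j))%N.
  move=> ij jn; have st : sorted (relpre key leq) s.
    by apply: sort_sorted => u v; apply: leq_total.
  apply: (sorted_leq_nth (leT := relpre key leq)) => //.
  - by move=> ? ? ?; apply: leq_trans.
  - by move=> ?; apply: leqnn.
  - by rewrite inE size_s (leq_ltn_trans ij).
  - by rewrite inE size_s.
have idx_lt v : v \in A -> (index v s < n)%N by rewrite -size_s index_mem mems.
(* Using no more blocks than vertices keeps every block nonempty. *)
pose t := minn T n.
have t0 : (0 < t)%N by rewrite leq_min T0.
have tn : (t <= n)%N by apply: geq_minr.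
pose part v := (index v s * t %/ n)%N.
have part_lt v : v \in A -> (part v < t)%N.
  by move=> vA; rewrite ltn_divLR // mulnC ltn_pmul2l // idx_lt.
(* The quotient [j * n / t] rounded up: the first index whose block is [j]. *)
pose cut j := ((j * n + t.-1) %/ t)%N.
have cutP j i : (cut j <= i)%N = (j * n <= i * t)%N.
  by rewrite -ltnS ltn_divLR // mulSn; move: (i * t)%N (j * n)%N => a b; lia.
have partE v j : (part v == j) = (cut j <= index v s < cut j.+1)%N.
  rewrite cutP ltnNge cutP -ltnNge eqn_leq -[(part v <= j)%N]ltnS.
  by rewrite ltn_divLR // leq_divRL // andbC.
pose block j := [set v in A | part v == j].
have cut_le j : (cut j <= cut j.+1)%N.
  by rewrite cutP; have := leqnn (cut j.+1); rewrite cutP mulSn; lia.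
have cut_n j : (j < t)%N -> (cut j.+1 <= n)%N.
  by move=> jt; rewrite cutP mulnC leq_pmul2l.
have card_block j : (j < t)%N -> #|block j| = (cut j.+1 - cut j)%N.
  move=> jt; rewrite -(count_iota (cut_le j) (cut_n j jt)).
  have -> : iota 0 n = [seq index v s | v <- s].
    apply: (@eq_from_nth _ 0%N); rewrite ?size_iota ?size_map // => i ilt.
    by rewrite nth_iota // (nth_map x0) ?size_s // index_uniq ?size_s.
  rewrite count_map -size_filter.
  rewrite -(card_uniqP (filter_uniq _ us)) -cardsE; apply: eq_card => v.
  by rewrite !inE mem_filter mems /= partE andbC.
pose w := (n %/ t)%N.
have w0 : (0 < w)%N by rewrite divn_gt0.
have sizes j : (j < t)%N -> (w <= #|block j| <= w.+1)%N.
  move=> jt; rewrite card_block //.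
  have := divn_eq (j * n + t.-1)%N t; have := ltn_pmod (j * n + t.-1)%N t0.
  have := divn_eq (j.+1 * n + t.-1)%N t.
  have := ltn_pmod (j.+1 * n + t.-1)%N t0.
  have := divn_eq n t; have := ltn_pmod n t0; have := cut_le j.
  rewrite -/(cut j) -/(cut j.+1) -/w mulSn.
  move: (n %% t)%N ((n + j * n + t.-1) %% t)%N ((j * n + t.-1) %% t)%N.
  move=> a b c.
  move: (j * n)%N (cut j) (cut j.+1) (w) => u x y z xy a_t nE bt yE ct xE.
  have dE : (n + c = (y - x) * t + b)%N.
    have := leq_mul xy (leqnn t); rewrite mulnBl. lia.
  move: dE; move: (y - x)%N => g gE; apply/andP; split; rewrite -ltnS.
    by rewrite -(ltn_pmul2r t0) mulSn; lia.
  by rewrite -(ltn_pmul2r t0) !mulSn; lia.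
have blockP j v : v \in block j -> v \in A /\ part v = j.
  by rewrite inE => /andP[? /eqP].
exists [set block j | j : 'I_t]; split.
- apply/and3P; split.
  + rewrite eqEsubset; apply/andP; split; apply/subsetP => v.
      by case/bigcupP => _ /imsetP[j _ ->] /blockP[].
    move=> vA; apply/bigcupP.
    exists (block (part v)); last by rewrite inE vA /=.
    by apply/imsetP; exists (Ordinal (part_lt v vA)).
  + apply/trivIsetP => _ _ /imsetP[j _ ->] /imsetP[j' _ ->] neq.
    rewrite -setI_eq0; apply/eqP/setP => v; rewrite inE [RHS]inE.
    by apply: contraNF neq => /andP[/blockP[_ <-] /blockP[_ <-]].
  + apply/imsetP => -[j _ E]; have := sizes j (ltn_ord j).
    by rewrite -E cards0 leqNgt w0.
- move=> _ _ /imsetP[j _ ->] /imsetP[j' _ ->].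
  have /andP[_ h] := sizes j (ltn_ord j).
  have /andP[h' _] := sizes j' (ltn_ord j').
  by rewrite addn1 (leq_trans h).
- apply: leq_trans (leq_imset_card _ _) _.
  by rewrite -cardsT cardsT card_ord geq_minl.
(* If [n <= T], all blocks are singletons. *)
have [nT|Tn] := leqP n T.
  rewrite big1 // => _ /andP[/imsetP[j _ ->] /negP[]]; apply/monochromaticP.
  have tE : t = n by apply/minn_idPr.
  move=> u v /blockP[uA <-] /blockP[vA]; rewrite /part tE !mulnK // => uv.
  by rewrite -(nth_index x0 (_ : u \in s)) ?mems // -uv nth_index ?mems.
have tE : t = T by apply/minn_idPl/ltnW.
set Q := [set X in [set block j | j : 'I_t] | ~~ monochromatic phi X].
have cardQ : (#|Q| <= #|K|)%N.
  pose B := [set j : 'I_t | ~~ monochromatic phi (block j)].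
  have cut_lt (j : 'I_t) : (cut j < n)%N.
    have /andP[h _] := sizes j (ltn_ord j).
    have := leq_trans w0 h; rewrite card_block // subn_gt0 => lt.
    exact: leq_trans lt (cut_n _ _).
  (* If two blocks start with the same colour, everything between these starts has it too, so the
     earlier block is monochromatic. *)
  have inj : {in B &, injective (fun j : 'I_t => phi (nth x0 s (cut j)))}.
    suff mono (j j' : 'I_t) : (j < j')%N ->
        phi (nth x0 s (cut j)) = phi (nth x0 s (cut j')) ->
        monochromatic phi (block j).
      move=> j j'; rewrite !inE => /negP nj /negP nj' E; apply: val_inj => /=.
      by case: (ltngtP j j') => // [/mono/(_ E)|/mono/(_ (esym E))].
    move=> jj' E; apply/monochromaticP => u v.
    have const x : x \in block j -> key x = key (nth x0 s (cut j)).
      move=> xB; have [xA /eqP] := blockP _ _ xB.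
      rewrite partE => /andP[lo hi].
      have hi' : (index x s <= cut j')%N.
        apply: leq_trans (ltnW hi) _; rewrite cutP.
        have := leqnn (cut j'); rewrite cutP; apply: leq_trans.
        by rewrite leq_mul2r jj' orbT.
      rewrite -[x in LHS](nth_index x0 (_ : x \in s)) ?mems //.
      apply/eqP; rewrite eqn_leq (keyS _ _ lo (idx_lt _ xA)) andbT.
      by rewrite /key E; apply: keyS.
    move=> /const uE /const; rewrite -uE => /val_inj/enum_rank_inj->.
    by [].
  apply: leq_trans (_ : #|B| <= _)%N; last first.
    by rewrite -(card_in_imset inj) max_card.
  apply: leq_trans (leq_imset_card (fun j : 'I_t => block j) B).
  apply/subset_leq_card/subsetP => X.
  rewrite inE => /andP[/imsetP[j _ ->] nm]; apply/imsetP; exists j => //.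
  by rewrite inE.
have sumQ : (\sum_(X in Q) #|X| <= #|Q| * w.+1)%N.
  rewrite -sum_nat_const; apply: leq_sum => X; rewrite inE => /andP[].
  by case/imsetP => j _ -> _; have /andP[] := sizes j (ltn_ord j).
(* As [w >= 1], the bound [w + 1] on the block sizes is at most [2 * w]. *)
have wt : (w.+1 * T <= 2 * n)%N.
  have : (w * T <= n)%N by rewrite -tE leq_trunc_div.
  by move: w0; case: (w) => // w' _; rewrite !mulSn; lia.
rewrite (eq_bigl (mem Q)) => [|X]; last by rewrite /= inE.
apply: leq_trans (leq_mul sumQ (leqnn T)) _; rewrite -mulnA.
by apply: leq_trans (leq_mul cardQ wt) _; rewrite mulnCA mulnA.
Qed.

(** * Resampling within parts *)

Section Resampling.
Variables (R : realFieldType) (k : nat) (V : finType).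
Variables (p : 'I_k -> V -> R) (q : 'I_k -> V * V -> R).
Hypothesis pP : forall i, distr (p i).
Hypothesis q_ge0 : forall i u, 0 <= q i u.
Hypothesis q_fst : forall i v, \sum_(u | u.1 == v) q i u = p i v.
Hypothesis q_snd : forall i v, \sum_(u | u.2 == v) q i u = p i v.

Lemma distr_coupling i : distr (q i).
Proof.
split=> // ; have [_ <-] := pP i.
rewrite (partition_big fst predT) //=.
by apply: eq_bigr => v _; rewrite q_fst.
Qed.

(** The hybrids leading from the original point, at [s = 0], to the resampled one, at [s = k]. *)
Definition mix (s : nat) (z : {ffun 'I_k -> V * V}) : {ffun 'I_k -> V} :=
  [ffun i : 'I_k => if (i < s)%N then (z i).2 else (z i).1].

Lemma mixS (i : 'I_k) z : mix i.+1 z = upd (mix i z) i (z i).2.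
Proof.
apply/ffunP => j; rewrite !ffunE ltnS leq_eqVlt.
have [->|neq] := eqVneq j i; rewrite ?eqxx //.
by rewrite (_ : (j == i :> nat) = false) //; apply: negPf.
Qed.

Lemma Ex_mix (s : nat) (F : {ffun 'I_k -> V} -> R) :
  Ex q (fun z => F (mix s z)) = Ex p F.
Proof.
pose h (i : 'I_k) (u : V * V) := if (i < s)%N then u.2 else u.1.
apply: (@Ex_pushforward _ _ _ p _ q h F) => i v.
by rewrite /h; case: (i < s)%N.
Qed.

(** Consecutive hybrids differ only at [i], where the decoder sees just the code. If [f] changes,
    then the codes differ, or decoding fails at one of the two hybrids, both of which have law
    [p]. *)
Lemma Ex_resample_all (K : finType) (f : {ffun 'I_k -> V} -> bool)
    (phi : 'I_k -> V -> K) (g : 'I_k -> K -> {ffun 'I_k -> V} -> bool)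
    (err eta : R) :
  (forall i c x v, g i c (upd x i v) = g i c x) ->
  (forall i, Ex p (fun x => (f x != g i (phi i (x i)) x)%:R) <= err) ->
  (forall i, \sum_u q i u * (phi i u.1 != phi i u.2)%:R <= eta) ->
  Ex q (fun z => (f (mix 0 z) != f (mix k z))%:R) <= k%:R * (2 * err + eta).
Proof.
move=> g_indep g_err phi_eta; have qP := distr_coupling.
pose diff (s : nat) z : R := (f (mix s z) != f (mix s.+1 z))%:R.
have tele s z : (f (mix 0 z) != f (mix s z))%:R <= \sum_(i < s) diff i z.
  elim: s => [|s IHs]; first by rewrite eqxx big_ord0.
  rewrite big_ord_recr /=; apply: le_trans (lerD IHs (lexx _)).
  apply: le_trans (ler_indicatorU _ _ _); apply: ler_indicator.
  by case: (f _); case: (f _); case: (f _).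
apply: le_trans (ler_Ex qP (tele k)) _.
rewrite Ex_sum mulr_natl -[k in leRHS]card_ord -sumr_const.
apply: ler_sum => i _.
apply: le_trans (_ : Ex q (fun z =>
   (f (mix i z) != g i (phi i (mix i z i)) (mix i z))%:R
   + (f (mix i.+1 z) != g i (phi i (mix i.+1 z i)) (mix i.+1 z))%:R
   + (phi i (z i).1 != phi i (z i).2)%:R) <= _).
  apply: ler_Ex => // z; rewrite /diff mixS g_indep upd_at.
  have -> : mix i z i = (z i).1 by rewrite ffunE ltnn.
  apply: le_trans (lerD (ler_indicatorU _ _ _) (lexx _)).
  apply: le_trans (ler_indicatorU _ _ _); apply: ler_indicator.
  have [->|] := eqVneq (phi i (z i).1); last by rewrite orbT.
  by case: (f _); case: (f _); case: (g _ _ _).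
rewrite !ExD mulr2n mulrDl !mul1r; apply: lerD; first apply: lerD.
- by rewrite (Ex_mix i (fun x => (f x != g i (phi i (x i)) x)%:R)).
- by rewrite (Ex_mix i.+1 (fun x => (f x != g i (phi i (x i)) x)%:R)).
- by rewrite (Ex_coord qP i (fun u => (phi i u.1 != phi i u.2)%:R)).
Qed.

End Resampling.

Definition uniform (R : realFieldType) (V : finType) (A : {set V})
    (v : V) : R :=
  (v \in A)%:R / #|A|%:R.

Lemma distr_uniform (R : realFieldType) (V : finType) (A : {set V}) :
  A != set0 -> distr (uniform R A).
Proof.
move=> A0; split=> [v|]; first by rewrite mulr_ge0 ?invr_ge0.
rewrite -mulr_suml -natr_sum -big_mkcond sum1_card mulfV //.
by rewrite pnatr_eq0 cards_eq0.
Qed.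

(* The pair obtained from a uniform vertex of A by resampling it within its
   part. *)
Definition part_coupling (R : realFieldType) (V : finType) (A : {set V})
    (P : {set {set V}}) (u : V * V) : R :=
  \sum_(X in P) ((u.1 \in X) && (u.2 \in X))%:R / (#|A|%:R * #|X|%:R).

Section PartCoupling.
Variables (R : realFieldType) (V : finType) (A : {set V}) (P : {set {set V}}).
Hypothesis PA : partition P A.

Lemma part_coupling_ge0 u : 0 <= part_coupling R A P u.
Proof. by apply: sumr_ge0 => X _; rewrite mulr_ge0 ?invr_ge0 ?mulr_ge0. Qed.

Lemma card_part_neq0 X : X \in P -> #|X|%:R != 0 :> R.
Proof.
move=> XP; rewrite pnatr_eq0 cards_eq0.
by apply: contraTneq XP => ->; have /and3P[] := PA.
Qed.

Lemma sum_in_parts v : \sum_(X in P) (v \in X)%:R = (v \in A)%:R :> R.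
Proof.
have /and3P[/eqP covP /trivIsetP tI _] := PA.
have [vA|vA] := boolP (v \in A); last first.
  rewrite big1 // => X XP; apply/eqP; rewrite pnatr_eq0 eqb0.
  apply: contra vA => vX; rewrite -covP; apply/bigcupP; by exists X.
move: vA; rewrite -covP => /bigcupP[X XP vX].
rewrite (bigD1 X) //= vX big1 ?addr0 // => Y /andP[YP YX].
have /pred0P/(_ v) := tI _ _ YP XP YX.
by rewrite /= vX andbT => ->.
Qed.

Lemma part_coupling_fst v :
  \sum_(u | u.1 == v) part_coupling R A P u = uniform R A v.
Proof.
rewrite /part_coupling exchange_big /uniform -sum_in_parts mulr_suml /=.
apply: eq_bigr => X XP.
transitivity (\sum_(w in X) (v \in X)%:R / (#|A|%:R * #|X|%:R) : R).
  rewrite [RHS]big_mkcond.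
  rewrite (reindex (fun w => (v, w))) /=; last first.
    by exists snd => [w|[v' w]] //; rewrite inE /= => /eqP->.
  rewrite big_mkcond; apply: eq_bigr => w _; rewrite eqxx.
  by case: (w \in X); rewrite ?andbT // andbF mul0r.
rewrite sumr_const -[LHS]mulr_natr invfM -!mulrA mulVf ?mulr1 //.
exact: card_part_neq0.
Qed.

Lemma part_coupling_snd v :
  \sum_(u | u.2 == v) part_coupling R A P u = uniform R A v.
Proof.
rewrite -part_coupling_fst.
rewrite (reindex (fun u : V * V => (u.2, u.1))) /=; last first.
  by exists (fun u => (u.2, u.1)) => -[].
apply: eq_bigr => u _; apply: eq_bigr => X _; by rewrite andbC.
Qed.

(** The two vertices share a part, so different colours require one that is not monochromatic; the
    part [X] is hit with probability [#|X| / #|A|]. *)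
Lemma part_coupling_color (K : finType) (phi : V -> K) :
  \sum_u part_coupling R A P u * (phi u.1 != phi u.2)%:R
    <= (\sum_(X in P | ~~ monochromatic phi X) #|X|)%:R / #|A|%:R.
Proof.
rewrite natr_sum mulr_suml.
under eq_bigr do rewrite mulr_suml.
rewrite exchange_big /= big_mkcondr; apply: ler_sum => X XP.
have [mX|nX] := boolP (monochromatic phi X).
  rewrite big1 // => u _.
  case: (boolP (_ && _)) => [/andP[u1 u2]|]; last by rewrite !mul0r.
  by rewrite (monochromaticP _ _ mX _ _ u1 u2) eqxx mulr0.
apply: le_trans (_ : \sum_(u | (u.1 \in X) && (u.2 \in X))
    (#|A|%:R * #|X|%:R)^-1 <= _).
  rewrite [leRHS]big_mkcond; apply: ler_sum => u _.
  case: (_ && _); last by rewrite !mul0r.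
  by rewrite mul1r ler_piMr ?invr_ge0 ?mulr_ge0 //; case: (_ == _).
rewrite (eq_bigl (mem (setX X X))) => [|u]; last by rewrite /= inE.
rewrite sumr_const cardsX -[leLHS]mulr_natr.
by rewrite natrM invfM mulrACA mulVf ?mulr1 ?card_part_neq0 // mulrC.
Qed.

End PartCoupling.

(** * Homogeneity *)

Definition cell (k : nat) (V : finType) (X : 'I_k -> {set V}) :
    {set {ffun 'I_k -> V}} :=
  [set x : {ffun 'I_k -> V} | [forall i, x i \in X i]].

Lemma card_cell (k : nat) (V : finType) (X : 'I_k -> {set V}) :
  #|cell X| = (\prod_i #|X i|)%N.
Proof.
under eq_bigr do rewrite -sum1_card.
rewrite bigA_distr_big_dep -sum1_card; apply: eq_big => [x|x _].
  by rewrite inE; apply/forallP/familyP.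
by rewrite big1.
Qed.

Lemma sum_disagreements (R : realFieldType) (T : finType) (S : {set T})
    (f : T -> bool) :
  \sum_(x in S) \sum_(y in S) (f x != f y)%:R
  = 2 * #|[set x in S | f x]|%:R * (#|S|%:R - #|[set x in S | f x]|%:R) :> R.
Proof.
set a : R := #|[set x in S | f x]|%:R.
have aE : \sum_(x in S) (f x)%:R = a.
  rewrite -natr_sum -big_mkcondr sum1_card; congr (_%:R).
  by apply: eq_card => x; rewrite [RHS]inE.
have bE : \sum_(x in S) (~~ f x)%:R = #|S|%:R - a.
  apply/eqP; rewrite eq_sym subr_eq -aE -big_split /= -sum1_card natr_sum.
  by apply/eqP/eq_bigr => x _; case: (f x); rewrite ?addr0 ?add0r.
transitivity (\sum_(x in S) ((f x)%:R * (#|S|%:R - a) + (~~ f x)%:R * a)).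
  apply: eq_bigr => x _; rewrite -bE -aE; case: (f x).
    by rewrite mul1r mul0r addr0; apply: eq_bigr => y _; case: (f y).
  by rewrite mul1r mul0r add0r; apply: eq_bigr => y _; case: (f y).
by rewrite big_split /= -!mulr_suml aE bE; ring.
Qed.

(** Expanding the product of the sums over parts selects one cell [X], in which the original and the
    resampled point are independent and uniform. With density [d], they disagree with probability
    [2 * d * (1 - d)]. *)
Lemma Ex_part_coupling (R : realFieldType) (k : nat) (V : finType)
    (A : 'I_k -> {set V}) (P : 'I_k -> {set {set V}})
    (f : {ffun 'I_k -> V} -> bool) :
  Ex (fun i => part_coupling R (A i) (P i))
    (fun z => (f (mix 0 z) != f (mix k z))%:R)
  = \sum_(X : {ffun 'I_k -> {set V}} | [forall i, X i \in P i])
      (\prod_i (#|A i|%:R * #|X i|%:R)^-1)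
      * (2 * #|[set x in cell X | f x]|%:R
           * (\prod_i #|X i|%:R - #|[set x in cell X | f x]|%:R)).
Proof.
rewrite /Ex; under eq_bigr do rewrite bigA_distr_big_dep mulr_suml.
rewrite exchange_big /=.
rewrite [LHS](eq_bigl (fun X : {ffun 'I_k -> {set V}} =>
  [forall i, X i \in P i])); last by move=> X; apply/familyP/forallP.
apply: eq_bigr => X _; rewrite -natr_prod -card_cell -sum_disagreements.
rewrite (reindex (fun xy : {ffun 'I_k -> V} * {ffun 'I_k -> V} =>
  [ffun i => (xy.1 i, xy.2 i)])) /=; last first.
  exists (fun z => (mix 0 z, mix k z)) => [[x y] _|z _].
    by congr (_, _); apply/ffunP => i; rewrite !ffunE ?ltn_ord.
  by apply/ffunP => i; rewrite !ffunE ltn_ord; case: (z i).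
rewrite pair_big mulr_sumr [RHS]big_mkcond; apply: eq_bigr => -[x y] _ /=.
have -> : mix 0 [ffun i => (x i, y i)] = x.
  by apply/ffunP => i; rewrite !ffunE.
have -> : mix k [ffun i => (x i, y i)] = y.
  by apply/ffunP => i; rewrite !ffunE ltn_ord.
rewrite !inE; case: ifP => [/andP[/forallP xX /forallP yX]|/negbT out].
  congr (_ * _); apply: eq_bigr => i _.
  by rewrite !ffunE /= xX yX div1r.
have [i] : exists i, ~~ ((x i \in X i) && (y i \in X i)).
  apply/existsP; apply: contraR out; rewrite negb_exists => /forallP xy.
  apply/andP; split; apply/forallP => i;
    by have := xy i; rewrite negbK => /andP[].
by move=> /negPf out_i; rewrite (bigD1 i) //= !ffunE /= out_i !mul0r.
Qed.

Section Homogeneity.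
Variables (R : realType) (k : nat) (V : finType).
Variables (A : 'I_k -> {set V}) (E : {set {set V}}).
Hypothesis HE : kpartite_kgraph A E.

(** The condition on the [A i] excludes the points that list the vertices of an edge in the wrong
    order. *)
Definition edge_at (x : {ffun 'I_k -> V}) : bool :=
  [forall i, x i \in A i] && ([set x i | i : 'I_k] \in E).

Lemma part_uniq i j v : v \in A i -> v \in A j -> i = j.
Proof.
have [disjA _ _] := HE; move=> vi vj; apply/eqP; apply: contraT => /disjA.
by move=> /pred0P/(_ v); rewrite /= vi vj.
Qed.

Lemma card_edges_between (X : 'I_k -> {set V}) :
  (forall i, X i \subset A i) ->
  #|edges_between E X| = #|[set x in cell X | edge_at x]|.
Proof.
move=> XA; have [disjA coverA edgeA] := HE.
have capX (x : {ffun 'I_k -> V}) i :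
    x \in cell X -> [set x j | j : 'I_k] :&: A i = [set x i].
  rewrite inE => /forallP xX; apply/setP => v; rewrite !inE.
  apply/andP/eqP => [[/imsetP[j _ ->] xi]|->].
    by rewrite (part_uniq xi (subsetP (XA j) _ (xX j))).
  by rewrite imset_f // (subsetP (XA i)).
have inj : {in [set x in cell X | edge_at x] &,
    injective (fun x : {ffun 'I_k -> V} => [set x i | i : 'I_k])}.
  move=> x y; rewrite inE => /andP[xX _]; rewrite inE => /andP[yX _] xy.
  apply/ffunP => i; have := capX x i xX; rewrite xy capX //.
  by move/setP/(_ (x i)); rewrite !inE eqxx => /eqP.
rewrite -(card_in_imset inj); apply: eq_card => e; rewrite inE.
apply/andP/imsetP => [[eE /forallP eX]|[x]]; last first.
  rewrite inE => /andP[xX /andP[_ xE]] ->; split=> //; apply/forallP => i.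
  rewrite (_ : _ :&: X i = [set x i]) ?cards1 //; apply/eqP.
  rewrite eqEsubset -{1}(capX x i xX) setIS //= sub1set inE imset_f //=.
  by move: xX; rewrite inE => /forallP.
have /fin_all_exists[y yE] i : exists v, e :&: X i = [set v] by apply/cards1P.
have yX i : y i \in X i.
  by have := set11 (y i); rewrite -yE => /setIP[].
have eEy : e = [set [ffun i => y i] i | i : 'I_k].
  apply/setP => v; apply/idP/imsetP => [ve|[i _ ->]]; last first.
    by rewrite ffunE; have := set11 (y i); rewrite -yE => /setIP[].
  have : v \in \bigcup_i A i by rewrite coverA inE.
  case/bigcupP => i _ vi; exists i; rewrite // ffunE.
  have /eqP/cards1P[w wE] := edgeA e eE i.
  have vw : v = w by apply/set1P; rewrite -wE inE ve.
  have yw : y i = w.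
    apply/set1P; rewrite -wE inE (subsetP (XA i)) // andbT.
    by have := set11 (y i); rewrite -yE => /setIP[].
  by rewrite vw yw.
exists [ffun i => y i] => //; rewrite !inE /edge_at -eEy eE andbT.
by apply/andP; split; apply/forallP => i; rewrite ffunE // (subsetP (XA i)).
Qed.

Lemma densityE (X : 'I_k -> {set V}) :
  (forall i, X i \subset A i) ->
  density R E X = #|[set x in cell X | edge_at x]|%:R / #|cell X|%:R.
Proof.
by move=> XA; rewrite /density card_edges_between // card_cell natr_prod.
Qed.

Lemma density_itv (X : 'I_k -> {set V}) :
  (forall i, X i \subset A i) -> 0 <= density R E X <= 1.
Proof.
move=> XA; rewrite densityE // divr_ge0 //=.
have [->|N0] := eqVneq #|cell X| 0%N; first by rewrite invr0 mulr0.
rewrite ler_pdivrMr ?ltr0n ?lt0n // mul1r ler_nat subset_leq_card //.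
by apply/subsetP => x; rewrite inE => /andP[].
Qed.

(** If [eps < d < 1 - eps], then [2 * d * (1 - d) >= eps], because [d] or [1 - d] is at least one
    half. Hence [eps] times the measure of the inhomogeneous cells is at most [eps ^+ 2]. *)
Lemma homogeneous_of_resampling (eps : R) (P : 'I_k -> {set {set V}}) :
  (forall i, A i != set0) -> (forall i, partition (P i) (A i)) ->
  0 < eps ->
  Ex (fun i => part_coupling R (A i) (P i))
    (fun z => (edge_at (mix 0 z) != edge_at (mix k z))%:R) <= eps ^+ 2 ->
  homogeneous_partition eps A E P.
Proof.
move=> A0 PA eps0; rewrite Ex_part_coupling => bound.
have sub (X : {ffun 'I_k -> {set V}}) i :
    [forall i, X i \in P i] -> X i \subset A i.
  move=> /forallP/(_ i) XP; have /and3P[/eqP <- _ _] := PA i.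
  exact: bigcup_sup XP.
pose nA : R := \prod_i #|A i|%:R.
have nA0 : 0 < nA by apply: prodr_gt0 => i _; rewrite ltr0n card_gt0.
pose a (X : {ffun 'I_k -> {set V}}) : R := #|[set x in cell X | edge_at x]|%:R.
pose N (X : {ffun 'I_k -> {set V}}) : R := \prod_i #|X i|%:R.
pose term (X : {ffun 'I_k -> {set V}}) : R :=
  (\prod_i (#|A i|%:R * #|X i|%:R)^-1) * (2 * a X * (N X - a X)).
have N0 (X : {ffun 'I_k -> {set V}}) : [forall i, X i \in P i] -> 0 < N X.
  move=> /forallP XP; apply: prodr_gt0 => i _; rewrite lt0r ler0n andbT.
  exact: card_part_neq0 (PA i) _ (XP i).
have termE (X : {ffun 'I_k -> {set V}}) : [forall i, X i \in P i] ->
    term X * nA = 2 * density R E X * (1 - density R E X) * N X.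
  move=> XP; have NX := N0 X XP.
  rewrite densityE => [|i]; last exact: sub.
  rewrite card_cell natr_prod -/(N X) -/(a X) /term prodfV big_split /=.
  rewrite -/nA -/(N X).
  by field; rewrite !lt0r_neq0.
rewrite /homogeneous_partition -/nA -(ler_pM2l eps0) mulrA -expr2.
apply: le_trans (ler_wpM2r (ltW nA0) bound).
rewrite mulr_sumr mulr_suml [leLHS]big_mkcondr; apply: ler_sum => X XP.
have /andP[d0 d1] := density_itv (fun i => sub X i XP).
rewrite -/(a X) -/(N X) -/(term X) termE //; have NX := N0 X XP.
rewrite /homogeneous d0 d1 andbT /=; set d := density R E X in d0 d1 *.
case: ifP => [|_]; last by apply: mulr_ge0; [nra | exact: ltW].
rewrite negb_or -!ltNge => /andP[eps_d d_eps].
apply: ler_wpM2r; [exact: ltW | nra].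
Qed.

End Homogeneity.

(** * Slicewise VC-dimension *)

Lemma vc_dim_shattered (V : finType) (W : {set V}) (adj : rel V) (d : nat)
    (u : d.-tuple V) :
  shattered W adj u -> (d <= vc_dim W adj)%N.
Proof.
move=> sh; have /and3P[uu _ _] := sh.
have dV : (d < #|V|.+1)%N.
  by rewrite ltnS -(size_tuple u) -(card_uniqP uu) max_card.
by apply: (leq_bigmax_cond (Ordinal dV)); apply/existsP; exists u.
Qed.

Lemma slicewise_vc_dim_shattered (k : nat) (V : finType) (E : {set {set V}})
    (v : (k - 2).-tuple V) (d : nat) (u : d.-tuple V) :
  uniq v -> shattered (link_vertices v) (link E v) u ->
  (d <= slicewise_vc_dim k E)%N.
Proof.
move=> uv /vc_dim_shattered/leq_trans; apply.
exact: (leq_bigmax_cond (F := fun v : (k - 2).-tuple V =>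
  vc_dim (link_vertices v) (link E v)) v).
Qed.

(** Fixing all coordinates but [i] and [j] leaves the link of the [k - 2] fixed vertices between
    [A i] and [A j], so shattered values [u t] are shattered in that link. *)
Lemma pair_vc_le_edge_at (k D : nat) (V : finType) (A : 'I_k -> {set V})
    (E : {set {set V}}) :
  kpartite_kgraph A E -> (slicewise_vc_dim k E <= D)%N ->
  pair_vc_le D (edge_at A E).
Proof.
move=> HE sD x i j u nij all; have [_ _ edgeA] := HE.
have uniqA := part_uniq HE.
have nji : j != i by rewrite eq_sym.
have at_i y v w : upd (upd y i v) j w i = v :> V.
  by rewrite upd_neq // upd_at.
(* The full trace provides edges, which place every [u t] and every fixed [x l] in its own part. *)
have [w0 w0E] := all setT.
have edge0 t : edge_at A E (upd (upd x i (u t)) j w0) by rewrite w0E inE.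
have uA t : u t \in A i.
  by have /andP[/forallP/(_ i)] := edge0 t; rewrite at_i.
have xA l : l != i -> l != j -> x l \in A l.
  move=> li lj; have /andP[/forallP/(_ l)] := edge0 ord0.
  by rewrite !upd_neq.
have u_inj : injective u.
  move=> t t' tt'; have [w wE] := all [set t].
  by apply/eqP; rewrite eq_sym -in_set1 -wE -tt' wE set11.
pose L := enum [set l | (l != i) && (l != j)].
have memL l : (l \in L) = (l != i) && (l != j) by rewrite mem_enum inE.
have sizeL : size [seq x l | l <- L] == (k - 2)%N.
  rewrite size_map -cardE.
  have -> : [set l | (l != i) && (l != j)] = ~: [set i; j].
    by apply/setP => l; rewrite !inE negb_or.
  by rewrite cardsCs setCK card_ord cards2 nij.
pose v : (k - 2).-tuple V := Tuple sizeL.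
have uv : uniq v.
  rewrite map_inj_in_uniq ?enum_uniq // => l l'; rewrite !memL.
  move=> /andP[li lj] /andP[li' lj'] E'; apply: (uniqA _ _ (x l)).
    exact: xA.
  by rewrite E' xA.
have vE y : reflect (exists2 l, (l != i) && (l != j) & y = x l) (y \in v).
  by apply: (iffP mapP) => -[l lL ->]; exists l; rewrite ?memL // -memL.
have notin_v y l : y \in A l -> (l == i) || (l == j) -> y \notin v.
  move=> yl lij; apply/negP => /vE[l' /andP[li lj] yE].
  have := xA _ li lj; rewrite -yE => /(uniqA _ _ _ yl) El.
  by move: lij; rewrite El (negPf li) (negPf lj).
have edge_set y z : [set y; z] :|: [set t in v] =
    [set upd (upd x i z) j y l | l : 'I_k].
  apply/setP => t; rewrite !inE; apply/idP/imsetP.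
    case/orP => [/orP[]/eqP->|/vE[l /andP[li lj] ->]].
    - by exists j; rewrite ?upd_at.
    - by exists i; rewrite ?at_i.
    - by exists l; rewrite ?upd_neq.
  case=> l _ ->; have [->|lj] := eqVneq l j; first by rewrite upd_at eqxx.
  have [->|li] := eqVneq l i; first by rewrite at_i eqxx orbT.
  by rewrite !upd_neq //; apply/orP; right; apply/vE; exists l; rewrite ?li.
suff sh : shattered (link_vertices v) (link E v) [tuple u t | t < D.+1].
  by have := leq_trans (slicewise_vc_dim_shattered uv sh) sD; rewrite ltnn.
apply/and3P; split.
- by rewrite /= map_inj_uniq ?enum_uniq.
- by apply/allP => y /mapP[t _ ->]; rewrite inE (notin_v _ i) ?eqxx.
apply/forallP => S; have [w wE] := all S.
have [wj|wj] := boolP (w \in A j).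
  apply/existsP; exists w; rewrite inE (notin_v _ j) ?eqxx ?orbT //=.
  apply/forallP => t; rewrite tnth_mktuple -wE /link !inE.
  rewrite (notin_v _ j) ?eqxx ?orbT // (notin_v _ i) ?eqxx //= edge_set.
  have -> : w != u t.
    by apply: contraNneq nij => E'; rewrite (uniqA i j w) // E'.
  rewrite /edge_at; have -> // :
    [forall l, upd (upd x i (u t)) j w l \in A l] = true.
  apply/forallP => l; have [->|lj] := eqVneq l j; first by rewrite upd_at.
  have [->|li] := eqVneq l i; first by rewrite at_i.
  by rewrite !upd_neq ?xA.
(* A value outside [A j] has empty trace but may be one of the fixed vertices, so [u ord0] replaces
   it: an edge joining it to some [u t] would miss [A j]. *)
apply/existsP; exists (u ord0); rewrite inE (notin_v _ i) ?eqxx //=.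
apply/forallP => t; rewrite tnth_mktuple -wE /edge_at /link.
have -> : [forall l, upd (upd x i (u t)) j w l \in A l] = false.
  by apply/negbTE/forallPn; exists j; rewrite upd_at.
rewrite andFb eqbF_neg !negb_and; apply/orP; right; apply/orP; right.
apply/orP; right; apply/negP => /edgeA/(_ j)/eqP/cards1P[y yE].
have := set11 y; rewrite -yE edge_set => /setIP[/imsetP[l _ ->]].
have [->|lj] := eqVneq l j.
  by rewrite upd_at => /(uniqA _ _ _ (uA ord0)) E'; rewrite E' eqxx in nij.
have [->|li] := eqVneq l i.
  by rewrite at_i => /(uniqA _ _ _ (uA t)) E'; rewrite E' eqxx in nij.
by rewrite !upd_neq // => /(uniqA _ _ _ (xA _ li lj)) E'; rewrite E' eqxx in lj.
Qed.

(** * Trivial cases and the final choice of parameters *)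

Lemma depends_only_on_setT (I V : finType) (f : {ffun I -> V} -> bool) :
  depends_only_on setT f.
Proof. by move=> x y xy; congr f; apply/ffunP => i; apply: xy; rewrite inE. Qed.

(** For [eps >= 1/2] every density is close to 0 or 1. An empty [A i] has no parts, hence there are
    no cells at all. *)
Lemma trivial_partition (R : realType) (k : nat) (V : finType)
    (A : 'I_k -> {set V}) (E : {set {set V}}) (eps : R) :
  kpartite_kgraph A E -> 0 < eps -> 2^-1 <= eps \/ (exists i, A i = set0) ->
  exists P : 'I_k -> {set {set V}},
    [/\ forall i, partition (P i) (A i), equipartition P,
        homogeneous_partition eps A E P & forall i, (#|P i| <= 1)%N].
Proof.
move=> HE eps0 triv.
exists (fun i => if A i == set0 then set0 else [set A i]); split.
- move=> i; case: eqP => [->|/eqP A0].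
    rewrite /partition /cover big_set0 eqxx inE andbT.
    by apply/trivIsetP => X Y; rewrite inE.
  rewrite /partition /cover big_set1 eqxx inE eq_sym A0 andbT.
  by apply/trivIsetP => X Y; rewrite !inE => /eqP-> /eqP->; rewrite eqxx.
- move=> i X Y; case: eqP => _; rewrite !inE // => /eqP-> /eqP->.
  exact: leq_addr.
- rewrite /homogeneous_partition big1 ?mulr_ge0 ?prodr_ge0 ?ltW // => X.
  case/andP => /forallP XP; case: triv => [half|[i Ai]]; last first.
    by have := XP i; rewrite Ai eqxx inE.
  have XA i : X i \subset A i.
    by have := XP i; case: eqP => _; rewrite !inE // => /eqP->.
  case/negP; rewrite /homogeneous.
  have /andP[d0 d1] := density_itv R HE XA; rewrite d0 d1 andbT /=.
  by have [//|h] := leP (density R E X) eps; apply/orP; right; lra.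
- by move=> i; case: eqP; rewrite ?cards0 ?cards1.
Qed.

Theorem theorem1p3 (R : realType) (k D : nat) (hk : (3 <= k)%N)
    (hD : (1 <= D)%N) :
  exists C : R,
    forall (V : finType) (A : 'I_k -> {set V}) (E : {set {set V}}),
      kpartite_kgraph A E ->
      (slicewise_vc_dim k E <= D)%N ->
      forall eps : R, 0 < eps ->
      exists P : 'I_k -> {set {set V}},
        [/\ forall i, partition (P i) (A i),
            equipartition P,
            homogeneous_partition eps A E P
          & forall i, #|P i|%:R <= 2 `^ ((1 / eps) `^ C)].
Proof.
(* The index [k - 2] stands for the [k - 1] coordinates other than the encoded one. *)
have [e code_e] := codable_poly R (k - 2) hD.
(* Each of the [k] coordinates costs [4 / m] in [Ex_resample_all], in total [1 / M ^ 2], which is at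
   most [eps ^+ 2] once [M > 1 / eps]. *)
pose m M := (4 * k * M ^ 2)%N.
pose h M := (m M + m M ^ e)%N.
have mP : poly_bounded m.
  exact: poly_boundedM (poly_bounded_cst _) (poly_boundedX 2 poly_bounded_id).
have [e' he'] := poly_boundedD mP (poly_boundedX e mP).
exists (e' * 2)%:R => V A E HE sD eps eps0.
have bound1 : 1 <= 2 `^ ((1 / eps) `^ (e' * 2)%:R) :> R.
  by rewrite -[leLHS](powRr0 2) ler_powR ?powR_ge0 // ler1n.
have [triv|] := boolP ((2^-1 <= eps) || [exists i, A i == set0]).
  have [|P [PA Peq Phom Pcard]] := trivial_partition HE eps0.
    by case/orP: triv; [left|move=> /existsP[i /eqP Ai]; right; exists i].
  exists P; split=> // i; apply: le_trans bound1.
  by rewrite -[1]/(1%:R) ler_nat Pcard.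
rewrite negb_or -ltNge => /andP[eps_lt /existsPn A0].
pose y := 1 / eps; pose M := (Num.truncn y).+1.
have y2 : 2 < y by rewrite /y ltr_pdivlMr //; lra.
have yM : y < M%:R by apply: truncnS_gt.
have M2 : (2 <= M)%N by rewrite -(ler_nat R) ltW // (lt_trans y2).
(* This is the source of the factor 2 in the exponent [e' * 2]: [M <= y + 1 <= y ^+ 2], as
   [y > 2]. *)
have My : M%:R <= y ^+ 2.
  have : (Num.truncn y)%:R <= y by rewrite truncn_le; lra.
  by rewrite -natr1; nra.
have k0 : (0 < k)%N by apply: leq_trans hk.
have m2 : (2 <= m M)%N by rewrite /m; nia.
have [K cardK codK] := code_e _ m2.
pose p i := uniform R (A i).
have pP i : distr (p i) by apply: distr_uniform.
have edge_vc := pair_vc_le_edge_at HE sD.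
have cod i : codable K p (edge_at A E) i (m M)%:R^-1.
  apply: (codK _ _ _ _ _ (~: [set i])) => //.
  - by rewrite !inE eqxx.
  - rewrite (_ : _ |: _ = setT); first exact: depends_only_on_setT.
    by apply/setP => j; rewrite !inE orbN.
  - by rewrite cardsCs setCK card_ord cards1; lia.
have /fin_all_exists[phi /fin_all_exists[g codE]] := cod.
(* As [#|K| <= 2 ^ (m M ^ e)], the parts that are not monochromatic have measure at most
   [2 * #|K| / T <= 2 / m M]. *)
pose T := (m M * 2 ^ (m M ^ e))%N.
have T0 : (0 < T)%N by rewrite muln_gt0 expn_gt0 andbT ltnW.
have /fin_all_exists[P PE] i := exists_equipartition (A i) (phi i) T0.
have PA i : partition (P i) (A i) by have [] := PE i.
exists P; split=> // [i X Y XP YP||i].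
- by have [_ /(_ X Y XP YP)] := PE i.
- apply: homogeneous_of_resampling => //.
  have color i : \sum_u part_coupling R (A i) (P i) u
      * (phi i u.1 != phi i u.2)%:R <= 2 / (m M)%:R.
    apply: le_trans (part_coupling_color R (PA i) (phi i)) _.
    have nA : 0 < #|A i|%:R :> R by rewrite ltr0n card_gt0.
    have mM : 0 < (m M)%:R :> R by rewrite ltr0n ltnW.
    rewrite ler_pdivrMr // mulrAC ler_pdivlMr // -!natrM ler_nat.
    have [_ _ _ /= bad] := PE i.
    rewrite -(leq_pmul2r (_ : 0 < 2 ^ (m M ^ e))%N) ?expn_gt0 // -mulnA.
    apply: leq_trans bad _; rewrite mulnAC leq_mul //.
  apply: le_trans (Ex_resample_all (p := p) (g := g)
    (err := (m M)%:R^-1) pP _ _ _ _ _ color) _.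
  + by move=> i u; apply: part_coupling_ge0.
  + by move=> i v; apply: part_coupling_fst.
  + by move=> i v; apply: part_coupling_snd.
  + by move=> i c x v; have [] := codE i.
  + by move=> i; have [_] := codE i.
  have kR : 0 < k%:R :> R by rewrite ltr0n.
  have M0 : 0 < M%:R :> R by rewrite ltr0n.
  have -> : k%:R * (2 * (m M)%:R^-1 + 2 / (m M)%:R) = M%:R^-1 ^+ 2 :> R.
    by rewrite /m natrM natrM natrX; field; rewrite !lt0r_neq0.
  rewrite lerXn2r ?nnegrE ?invr_ge0 ?ltW //.
  by rewrite -[eps]invrK ltf_pV2 ?posrE ?invr_gt0 // -div1r.
have [_ _ cardP _] := PE i.
apply: le_trans (_ : (2 ^ (M ^ e'))%:R <= _).
  rewrite ler_nat; apply: leq_trans cardP _.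
  apply: leq_trans (_ : 2 ^ h M <= _)%N; last by rewrite leq_exp2l ?he'.
  by rewrite /h expnD leq_mul // ltnW // ltn_expl.
rewrite natrX -powR_mulrn // ler_powR ?ler1n // natrX mulnC.
rewrite powR_mulrn; last by rewrite divr_ge0 // ltW.
rewrite exprM lerXn2r // ?nnegrE //.
exact: exprn_ge0 (ltW (lt_trans _ y2)).
Qed.
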